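(* For $1<r<2$, let $t_1=t_1(r)$ denote the unique number $t$ satisfying $$2-r-t^{r-1}=\frac{1-t^r}{(1+t)^{r-1}(1-t)}-1,\qquad 0<t<1.$$ For $2<r<3$, let $t_2=t_2(r)$ denote the unique number $t$ satisfying $$r-2-t=\frac{(1+t)^{r-1}(1-t)}{1-t^r}-1,\qquad 0<t<1.$$ Let $a_1(r)=(2-r-t_1^{r-1})/r$ for $1<r<2$ and $a_2(r)=(r-2-t_2)/r$ for $2<r<3$. Then $a_1(r)>0$ for $1<r<2$ and $a_2(r)>0$ for $2<r<3$, and the following hold for all $n\ge 2$, all admissible weights ${\bf q}$ and all admissible ${\bf x}$. (i) If $1<r<2$ and $0<\alpha\le 1+a_1(r)$, then $$\frac{1}{1-(1-q)^{\alpha(r-1)}}\ \ge\ \left|\frac{A_n^{\alpha}-G_n^{\alpha}}{A_n^{\alpha}-M_{n,1/r}^{\alpha}}\right|.$$ (ii) If $r>2$ and $$\alpha\ \ge\ \begin{cases}1-a_2(r), & 2<r<3,\\[2pt] 1-\dfrac{1}{3r}, & 3\le r<4,\\[4pt] 1-\dfrac{r-2}{r^2}, & r\ge 4,\end{cases}$$ then $$\left|\frac{A_n^{\alpha}-G_n^{\alpha}}{A_n^{\alpha}-M_{n,1/r}^{\alpha}}\right|\ \ge\ \frac{1}{1-q^{\alpha(r-1)}}.$$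
   Context: Let $n\ge 2$. Admissible weights are ${\bf q}=(q_1,\dots,q_n)$ with $q_i>0$ and $\sum_{i=1}^n q_i=1$; $q=\min_i q_i$. Admissible points are ${\bf x}=(x_1,\dots,x_n)$ with $0\le x_1<x_2<\cdots<x_n$. The weighted power means are $M_{n,p}=M_{n,p}({\bf x};{\bf q})=\left(\sum_{i=1}^n q_ix_i^p\right)^{1/p}$ for real $p\neq 0$, and $M_{n,0}=\lim_{p\to 0}M_{n,p}=\prod_{i=1}^n x_i^{q_i}$. We write $A_n=M_{n,1}$ and $G_n=M_{n,0}$. *)

(* Defs.v *)
From mathcomp Require Import all_boot all_order all_algebra.
From mathcomp Require Import all_classical all_reals all_analysis.

Set Implicit Arguments.
Unset Strict Implicit.
Unset Printing Implicit Defensive.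

Import Order.TTheory GRing.Theory Num.Theory.

Local Open Scope classical_set_scope.
Local Open Scope ring_scope.

Definition admissible_weights (R : realType) (n : nat) (q : 'I_n -> R) : Prop :=
  (forall i, 0 < q i) /\ \sum_(i < n) q i = 1.

Definition admissible_points (R : realType) (n : nat) (x : 'I_n -> R) : Prop :=
  (forall i, 0 <= x i) /\ (forall i j : 'I_n, (i < j)%N -> x i < x j).

(* The neutral element 1 is harmless: admissible weights are at most 1. *)
Definition min_weight (R : realType) (n : nat) (q : 'I_n -> R) : R :=
  \big[Num.min/1]_(i < n) q i.

(* [powR] satisfies 0 `^ p = 0 for every p != 0 and 0 `^ 0 = 1.  Hence for
   p >= 0 the formula is the usual mean even if some x i vanishes; for p < 0 it
   is meaningful only when all x i are positive. *)
Definition power_mean (R : realType) (n : nat) (q x : 'I_n -> R) (p : R) : R :=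
  if p == 0 then \prod_(i < n) x i `^ q i
  else (\sum_(i < n) q i * x i `^ p) `^ (1 / p).

Definition arith_mean (R : realType) (n : nat) (q x : 'I_n -> R) : R :=
  power_mean q x 1.

Definition geom_mean (R : realType) (n : nat) (q x : 'I_n -> R) : R :=
  power_mean q x 0.

Definition mean_ratio (R : realType) (n : nat) (q x : 'I_n -> R)
    (r alpha : R) : R :=
  `| (arith_mean q x `^ alpha - geom_mean q x `^ alpha)
     / (arith_mean q x `^ alpha - power_mean q x (1 / r) `^ alpha) |.

Definition t1_spec (R : realType) (r t : R) : Prop :=
  0 < t < 1 /\
  2 - r - t `^ (r - 1) =
    (1 - t `^ r) / ((1 + t) `^ (r - 1) * (1 - t)) - 1.

Definition t2_spec (R : realType) (r t : R) : Prop :=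
  0 < t < 1 /\
  r - 2 - t = ((1 + t) `^ (r - 1) * (1 - t)) / (1 - t `^ r) - 1.

(* [xget 0 A] is a chosen element of A, and 0 if A is empty; so [t1 r] and
   [t2 r] are the intended numbers whenever the spec has a unique solution. *)
Definition t1 (R : realType) (r : R) : R := xget 0 [set t | t1_spec r t].
Definition t2 (R : realType) (r : R) : R := xget 0 [set t | t2_spec r t].

Definition a1 (R : realType) (r : R) : R := (2 - r - t1 r `^ (r - 1)) / r.
Definition a2 (R : realType) (r : R) : R := (r - 2 - t2 r) / r.

(* Meant for r > 2 only. *)
Definition alpha_bound (R : realType) (r : R) : R :=
  if r < 3 then 1 - a2 r
  else if r < 4 then 1 - 1 / (3 * r)
  else 1 - (r - 2) / r ^+ 2.

(* Main.v *)
Require Import Defs.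
From mathcomp Require Import all_boot all_order all_algebra.
From mathcomp Require Import all_classical all_reals all_analysis.
From mathcomp Require Import ring lra.
Import Order.TTheory GRing.Theory Num.Theory.
Import numFieldNormedType.Exports.
Set Implicit Arguments.
Unset Strict Implicit.
Unset Printing Implicit Defensive.
Local Open Scope classical_set_scope.
Local Open Scope ring_scope.

(**
Fix r > 1 and put m = sum q_i x_i^(1/r), so that M_(1/r) = m^r. With
y_i = x_i^(1/r) / m, a point of the simplex sum q_i y_i = 1, both claims
become bounds on

  F(y) = c (sum q_i y_i^r)^alpha + (1 - c) (prod y_i^(q_i))^(r alpha),

namely F >= 1 for c = (1 - q)^(alpha (r - 1)) when 1 < r < 2 ([mixed_ge1]),
and F <= 1 for c = q^(alpha (r - 1)) when r > 2 ([mixed_le1]). Only the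
extreme exponent alpha matters: the passage to the others is the convexity
of a power function ([powR_mix], [powR_mix_concave]), because u + v - uv and
uv majorize u and v.

At an extremum of F on the simplex either some y_k vanishes, and then the
geometric term drops out and an elementary estimate suffices, or the point
is critical. Transferring mass between two coordinates shows that at a
critical point all pairs (y_k, w y_k^r + v) lie on one line lam y, with
w = c (sum q_i y_i^r)^(alpha - 1) and v the geometric term. Summing against
the weights gives F = lam, and lam is w times the slope of y^r between any
two distinct coordinates ([critical_line]). For the lower bound on F strict
convexity of y^r is used once more: a line meets w y^r + v at most twice, so
y takes only two values. What is left is a two-point inequality, whose
worst case is that of equal weights ([two_point_upper], [two_point_lower]).

At equal weights, with t the quotient of the two values, the inequality
compares a power of S(t) = (1 + t)^r / (1 + t^r) with

  C(t) = (1 - t^r) / ((1 + t)^(r - 1) (1 - t))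

or with 1 / C(t). The equations for t1 and t2 say that r a1 = C(t1) - 1 and
r a2 = 1 / C(t2) - 1. Beyond the root, monotonicity of C and S <= 2^(r - 1)
suffice; before it, S <= (1 + t)^r and Bernoulli's inequality do. For r >= 3
the second estimate works for all t.
*)

(** * Bernoulli inequalities and convexity of powers *)

Section Bernoulli.
Context {R : realType}.
Implicit Types a b r s t x y : R.

Lemma powR_expR s b : 0 < s -> s `^ b = expR (b * ln s).
Proof. by move=> s0; rewrite /powR gt_eqF. Qed.

Lemma powRDpos x r s : 0 < x -> x `^ (r + s) = x `^ r * x `^ s.
Proof. by move=> x0; rewrite powRD// (gt_eqF x0) implybT. Qed.

(** All three Bernoulli inequalities come from exp(z) > 1 + z. Here, with
    s = exp(l), s^r - r s + r - 1 equals exp(l) times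
    exp((r - 1) l) - r + (r - 1) exp(- l), and both exponentials are bounded
    below by their tangents at 0. *)
Lemma bernoulli_gt1 r s : 1 < r -> 0 <= s -> s != 1 ->
  1 + r * (s - 1) < s `^ r.
Proof.
move=> r1; rewrite le_eqVlt => /predU1P[<- _|s0 s1].
  by rewrite powR0 ?gt_eqF//; lra.
have l0 : ln s != 0 by rewrite ln_eq0.
have se : s = expR (ln s) by rewrite lnK.
rewrite powR_expR// {1}se; set l := ln s in l0 *.
have h1 : 1 + (r - 1) * l < expR ((r - 1) * l).
  by apply: expR_gt1Dx; rewrite mulf_neq0// subr_eq0 gt_eqF.
have h2 : 1 - l < expR (- l) by apply: expR_gt1Dx; rewrite oppr_eq0.
have -> : r * l = (r - 1) * l + l by lra.
have e0 := expR_gt0 l.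
have ee : expR l * expR (- l) = 1 by rewrite expRxMexpNx_1.
rewrite expRD; move: h1 h2 e0 ee.
move: (expR _) (expR (- l)) (expR l) => A B C.
move=> h1 h2 C0 CB.
have h3 : (r - 1) * l + 1 - r + (r - 1) * (1 - l) < A - r + (r - 1) * B.
  have : (r - 1) * (1 - l) < (r - 1) * B by rewrite ltr_pM2l// subr_gt0.
  by lra.
have : 0 < (A - r + (r - 1) * B) * C by apply: mulr_gt0 => //; lra.
have -> : (A - r + (r - 1) * B) * C = A * C - r * C + (r - 1) * (C * B) by lra.
by rewrite CB; lra.
Qed.

Lemma bernoulli_lt0 b s : b < 0 -> 0 < s -> s != 1 ->
  1 + b * (s - 1) < s `^ b.
Proof.
move=> b0 s0 s1.
have l0 : ln s != 0 by rewrite ln_eq0.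
have se : s = expR (ln s) by rewrite lnK.
rewrite powR_expR// {1}se; set l := ln s in l0 *.
have h1 : 1 + b * l < expR (b * l).
  by apply: expR_gt1Dx; rewrite mulf_neq0// lt_eqF.
have h2 : 1 + l < expR l by exact: expR_gt1Dx.
have : b * expR l < b * (1 + l) by rewrite ltr_nM2l.
by lra.
Qed.

Lemma bernoulli_01 b s : 0 < b < 1 -> 0 < s -> s != 1 ->
  s `^ b < 1 + b * (s - 1).
Proof.
move=> /andP[b0 b1] s0 s1.
have l0 : ln s != 0 by rewrite ln_eq0.
have se : s = expR (ln s) by rewrite lnK.
rewrite powR_expR// {2}se; set l := ln s in l0 *.
have h1 : 1 - b * l < expR (- (b * l)).
  by apply: expR_gt1Dx; rewrite oppr_eq0 mulf_neq0// gt_eqF.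
have h2 : 1 + (1 - b) * l < expR ((1 - b) * l).
  by apply: expR_gt1Dx; rewrite mulf_neq0// subr_eq0 gt_eqF.
have -> : expR l = expR (b * l) * expR ((1 - b) * l).
  by rewrite -expRD; congr expR; lra.
have e0 := expR_gt0 (b * l).
have ee : expR (b * l) * expR (- (b * l)) = 1 by rewrite expRxMexpNx_1.
move: h1 h2 e0 ee.
move: (expR (b * l)) (expR (- (b * l))) (expR ((1 - b) * l)) => A B C.
move=> h1 h2 A0 AB.
have h3 : (1 - b) * (1 - b * l) < (1 - b) * B by rewrite ltr_pM2l// subr_gt0.
have h4 : b * (1 + (1 - b) * l) < b * C by rewrite ltr_pM2l.
have : 0 < ((1 - b) * B + b * C - 1) * A by apply: mulr_gt0 => //; lra.
have -> : ((1 - b) * B + b * C - 1) * A = (1 - b) * (A * B) + b * (A * C) - A.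
  by lra.
by rewrite AB; lra.
Qed.

Lemma bernoulli_ge1 r s : 1 <= r -> 0 <= s -> 1 + r * (s - 1) <= s `^ r.
Proof.
rewrite le_eqVlt => /predU1P[<- s0|r1 s0]; first by rewrite powRr1//; lra.
have [->|s1] := eqVneq s 1; first by rewrite powR1; lra.
exact/ltW/bernoulli_gt1.
Qed.

Lemma bernoulli_le1 b s : 0 <= b <= 1 -> 0 < s -> s `^ b <= 1 + b * (s - 1).
Proof.
move=> /andP[]; rewrite le_eqVlt => /predU1P[<- _ s0|b0].
  by rewrite powRr0; lra.
rewrite le_eqVlt => /predU1P[-> s0|b1 s0]; first by rewrite powRr1 ?(ltW s0)//; lra.
have [->|s1] := eqVneq s 1; first by rewrite powR1; lra.
by apply/ltW/bernoulli_01; rewrite ?b0.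
Qed.

Lemma powR_tangent_lt r m y : 1 < r -> 0 < m -> 0 <= y -> y != m ->
  m `^ r + r * m `^ (r - 1) * (y - m) < y `^ r.
Proof.
move=> r1 m0 y0 ym.
have -> : y `^ r = m `^ r * (y / m) `^ r.
  rewrite -powRM ?(ltW m0)//; last by rewrite divr_ge0// ltW.
  by rewrite mulrCA divff ?mulr1// gt_eqF.
have -> : m `^ r + r * m `^ (r - 1) * (y - m) =
          m `^ r * (1 + r * (y / m - 1)).
  have -> : m `^ r = m `^ (r - 1) * m.
    by rewrite mulrC mulr_powRB1 ?ltW//; lra.
  by field; rewrite gt_eqF.
rewrite ltr_pM2l ?powR_gt0//; apply: bernoulli_gt1 => //.
  by rewrite divr_ge0// ltW.
by apply: contra ym => /eqP h; rewrite -[y](divfK (lt0r_neq0 m0)) h mul1r.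
Qed.

Lemma powR_tangent r m y : 1 <= r -> 0 < m -> 0 <= y ->
  m `^ r + r * m `^ (r - 1) * (y - m) <= y `^ r.
Proof.
rewrite le_eqVlt => /predU1P[<- m0 y0|r1 m0 y0].
  by rewrite subrr powRr0 !powRr1 ?(ltW m0)//; lra.
have [->|ym] := eqVneq y m; first by rewrite subrr mulr0 addr0.
exact/ltW/powR_tangent_lt.
Qed.

Lemma powR_convex r s x y : 1 <= r -> 0 <= s <= 1 -> 0 <= x -> 0 <= y ->
  (s * x + (1 - s) * y) `^ r <= s * x `^ r + (1 - s) * y `^ r.
Proof.
move=> r1 /andP[s0 s1] x0 y0.
have [m0|m0] := eqVneq (s * x + (1 - s) * y) 0.
  rewrite m0 powR0; last by lra.
  by rewrite addr_ge0// mulr_ge0 ?powR_ge0//; lra.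
have {}m0 : 0 < s * x + (1 - s) * y.
  by rewrite lt_neqAle eq_sym m0 addr_ge0// mulr_ge0//; lra.
set m := _ + _ in m0 *.
have hx := powR_tangent r1 m0 x0.
have hy := powR_tangent r1 m0 y0.
have hx' : s * (m `^ r + r * m `^ (r - 1) * (x - m)) <= s * x `^ r.
  exact: ler_wpM2l.
have hy' : (1 - s) * (m `^ r + r * m `^ (r - 1) * (y - m)) <= (1 - s) * y `^ r.
  by apply: ler_wpM2l => //; lra.
have e : m `^ r = s * (m `^ r + r * m `^ (r - 1) * (x - m)) +
   (1 - s) * (m `^ r + r * m `^ (r - 1) * (y - m)).
  have em : m = s * x + (1 - s) * y by [].
  by move: (m `^ r) (m `^ (r - 1)) => P Q; rewrite em; ring.
by rewrite e lerD.
Qed.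

Lemma powR_superadd r x y : 1 <= r -> 0 < x -> 0 < y ->
  x `^ r + y `^ r <= (x + y) `^ r.
Proof.
move=> r1 x0 y0.
have h z : 0 < z -> z <= x + y -> z `^ r <= (x + y) `^ r * (z / (x + y)).
  move=> z0 zxy.
  have xy0 : 0 < x + y by rewrite addr_gt0.
  have {1}-> : z = (x + y) * (z / (x + y)).
    by rewrite mulrCA divff ?mulr1// gt_eqF.
  rewrite powRM ?divr_ge0 ?(ltW xy0) ?(ltW z0)//.
  rewrite ler_wpM2l ?powR_ge0// ge1r_powR// divr_gt0//=.
  by rewrite ler_pdivrMr// mul1r.
have hx : x <= x + y by lra.
have hy : y <= x + y by lra.
apply: le_trans (lerD (h x x0 hx) (h y y0 hy)) _.
by rewrite -mulrDr -mulrDl divff ?mulr1// gt_eqF// addr_gt0.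
Qed.

Lemma powR_le r x y : 0 <= r -> 0 <= x -> x <= y -> x `^ r <= y `^ r.
Proof. by move=> r0 x0 xy; rewrite ge0_ler_powR// nnegrE// (le_trans x0). Qed.

Lemma powR_lt r x y : 0 < r -> 0 <= x -> x < y -> x `^ r < y `^ r.
Proof.
by move=> r0 x0 xy; rewrite gt0_ltr_powR// nnegrE// (le_trans x0)// ltW.
Qed.

Lemma powR_lt1 r t : 0 < r -> 0 <= t < 1 -> t `^ r < 1.
Proof.
move=> r0 /andP[t0 t1].
by have := powR_lt r0 t0 t1; rewrite powR1.
Qed.

Lemma powR_ge1 r t : 0 <= r -> 1 <= t -> 1 <= t `^ r.
Proof. by move=> r0 t1; have := powR_le r0 ler01 t1; rewrite powR1. Qed.

End Bernoulli.

(** * Mixing of powers *)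

Section Mix.
Context {R : realType}.
Implicit Types a b g r s t u w x y : R.

(** Convexity of x^b: the numbers u a + (1 - u) g and u g have the same sum as
    u a and g, and enclose them. *)
Lemma powR_mix b u a g : 1 <= b -> 0 <= u <= 1 -> 0 <= g <= a ->
  u `^ b * a `^ b + (1 - u `^ b) * g `^ b <= (u * a + (1 - u) * g) `^ b.
Proof.
move=> b1 /andP[u0 u1] /andP[g0 ga].
have b0 : b != 0 by rewrite gt_eqF//; lra.
have a0 : 0 <= a by lra.
have [->|un0] := eqVneq u 0.
  by rewrite powR0// !mul0r !add0r !subr0 !mul1r.
have [->|un1] := eqVneq u 1.
  by rewrite powR1 subrr !mul0r !addr0 !mul1r.
have [->|gn0] := eqVneq g 0.
  by rewrite powR0// !mulr0 !addr0 powRM.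
have {}u0 : 0 < u by rewrite lt_neqAle eq_sym un0.
have {}u1 : u < 1 by rewrite lt_neqAle un1.
have {}g0 : 0 < g by rewrite lt_neqAle eq_sym gn0.
set T := u * a + (1 - u) * g.
have D1 : 0 <= u * (a - g) by apply: mulr_ge0; lra.
have D2 : 0 < g * (1 - u) by apply: mulr_gt0; lra.
pose D := u * (a - g) + g * (1 - u).
have D0 : 0 < D by rewrite /D; lra.
pose s := u * (a - g) / D.
have s01 : 0 <= s <= 1.
  by rewrite /s divr_ge0 ?(ltW D0)//= ler_pdivrMr// mul1r /D; lra.
have eua : u * a = s * T + (1 - s) * (u * g).
  by rewrite /s /T /D; field; rewrite gt_eqF.
have eg : g = (1 - s) * T + (1 - (1 - s)) * (u * g).
  by rewrite /s /T /D; field; rewrite gt_eqF.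
have T0 : 0 <= T by rewrite /T addr_ge0// mulr_ge0//; lra.
have ug0 : 0 <= u * g by rewrite mulr_ge0//; lra.
have h1 := powR_convex b1 s01 T0 ug0.
have s01' : 0 <= 1 - s <= 1 by lra.
have h2 := powR_convex b1 s01' T0 ug0.
rewrite -eua in h1; rewrite -eg in h2.
rewrite !powRM ?(ltW u0) ?(ltW g0)// in h1 h2.
move: h1 h2; move: (u `^ b) (a `^ b) (g `^ b) (T `^ b) => U A G X h1 h2.
by lra.
Qed.

(** Exponents below 1 follow from [powR_mix] with exponent 1 / b, applied to
    b-th powers. *)
Lemma powR_mix_concave b u a g w : 0 < b <= 1 -> 0 <= u <= 1 -> 0 <= g <= a ->
  0 <= w -> w <= u * a + (1 - u) * g ->
  w `^ b <= u `^ b * a `^ b + (1 - u `^ b) * g `^ b.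
Proof.
move=> /andP[b0 b1] /andP[u0 u1] /andP[g0 ga] w0 h.
have ib1 : 1 <= b^-1 by rewrite -invr1 lef_pV2// posrE.
have a0 : 0 <= a by lra.
have K x : 0 <= x -> (x `^ b) `^ b^-1 = x.
  by move=> x0; rewrite -powRrM divff ?powRr1// gt_eqF.
have ub : 0 <= u `^ b <= 1.
  by rewrite powR_ge0; have := powR_le (ltW b0) u0 u1; rewrite powR1.
have gab : 0 <= g `^ b <= a `^ b by rewrite powR_ge0/= powR_le// ltW.
have := powR_mix ib1 ub gab; rewrite !K// => h2.
set X := u `^ b * a `^ b + (1 - u `^ b) * g `^ b in h2 *.
have X0 : 0 <= X.
  by rewrite addr_ge0// mulr_ge0 ?powR_ge0// subr_ge0; case/andP: ub.
have : w <= X `^ b^-1 by exact: le_trans h h2.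
move=> /(powR_le (ltW b0) w0); rewrite -powRrM mulVf ?gt_eqF// powRr1//.
Qed.

(** Among two-point weights p1 >= p2, the equal ones minimize
    p1^(r - 1) (p1 x^r + p2 y^r) / (p1 x + p2 y)^r. With s = p2 / p1,
    convexity bounds (x + s y)^r by (1 - s) x^r + s (x + y)^r, and
    superadditivity of the r-th power does the rest. *)
Lemma superadd_ratio_weights r x y p1 p2 : 1 <= r -> 0 < x -> 0 < y ->
  0 < p2 <= p1 ->
  (p1 * x + p2 * y) `^ r * (x `^ r + y `^ r) <=
  (x + y) `^ r * (p1 `^ (r - 1) * (p1 * x `^ r + p2 * y `^ r)).
Proof.
move=> r1 x0 y0 /andP[p20 p21].
have p10 : 0 < p1 by lra.
pose s := p2 / p1.
have s01 : 0 <= s <= 1.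
  by rewrite /s divr_ge0 ?(ltW p10) ?(ltW p20)//= ler_pdivrMr// mul1r.
have -> : p1 * x + p2 * y = p1 * (s * (x + y) + (1 - s) * x).
  by rewrite /s; field; rewrite gt_eqF.
have -> : p1 `^ (r - 1) * (p1 * x `^ r + p2 * y `^ r) =
          p1 `^ r * (x `^ r + s * y `^ r).
  rewrite -[p1 `^ r]mulr_powRB1 ?(ltW p10)//; last lra.
  by rewrite /s; field; rewrite gt_eqF.
rewrite powRM ?(ltW p10)//; last first.
  by case/andP: s01 => ? ?; rewrite addr_ge0// mulr_ge0//; lra.
rewrite mulrCA -mulrA ler_pM2l ?powR_gt0//.
have xy0 : 0 <= x + y by lra.
have h1 := powR_convex r1 s01 xy0 (ltW x0).
have h2 := powR_superadd r1 x0 y0.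
have X0 := powR_gt0 r x0; have Y0 := powR_gt0 r y0.
apply: (@le_trans _ _ ((s * (x + y) `^ r + (1 - s) * x `^ r) *
   (x `^ r + y `^ r))); first by rewrite ler_wpM2r//; lra.
rewrite -subr_ge0.
set X := x `^ r in h2 *; set Y := y `^ r in h2 *; set Z := (x + y) `^ r in h2 *.
have -> : Z * (X + s * Y) - (s * Z + (1 - s) * X) * (X + Y) =
   (1 - s) * X * (Z - (X + Y)) by ring.
by case/andP: s01 => _ s1; rewrite mulr_ge0 ?subr_ge0// mulr_ge0 ?(ltW X0)// subr_ge0.
Qed.

End Mix.

(** * The normalized chord of the power function *)

Section Chord.
Context {R : realType}.
Implicit Types a b g r s t u w x y : R.

(** The absolute value makes the power continuous at 0, where [powR] jumps
    because negative bases are sent to 1. *)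
Lemma continuous_powR_norm p : 0 < p :> R -> continuous (fun x : R => `|x| `^ p).
Proof.
move=> p0 x; have [->|x0] := eqVneq x 0.
  apply/cvgrPdist_lt => e e0 /=; rewrite normr0 powR0 ?gt_eqF//.
  near=> z; rewrite sub0r normrN ger0_norm ?powR_ge0//.
  have -> : e = (e `^ p^-1) `^ p by rewrite -powRrM mulVf ?gt_eqF// powRr1// ltW.
  apply: powR_lt => //; near: z.
  have : 0 < e `^ p^-1 by exact: powR_gt0.
  by move=> /cvgr0_norm_lt; apply; exact: cvg_id.
apply: (@continuous_comp _ _ _ (fun x : R => `|x|) (fun x => x `^ p)).
  exact: norm_continuous.
apply/differentiable_continuous/derivable1_diffP/ex_derive/is_derive1_powR.
by rewrite normr_gt0.
Unshelve. all: by end_near. Qed.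

(** The slope of s^r between t and 1, divided by (1 + t)^(r - 1). *)
Definition chord r t : R := (1 - t `^ r) / ((1 + t) `^ (r - 1) * (1 - t)).

(** The sign of the logarithmic derivative of [chord r] on
    ]0, 1[ is that of this function, see [is_derive_lnchord]. *)
Definition chord_num r t : R := (2 - r) * (1 - t `^ r) + r * t - r * t `^ (r - 1).

(** The derivative is written so that its sign is read off Bernoulli's
    inequality for the exponent 2 - r; this is why [chord_num] is strictly
    monotone and hence of constant sign on ]0, 1[. *)
Lemma is_derive_chord_num r t : 0 < t -> is_derive t 1 (chord_num r)
  (r * (1 - t `^ (r - 2) * (1 + (2 - r) * (t - 1)))).
Proof.
move=> t0; rewrite /chord_num.
have h1 := is_derive1_powR r t0.
have h2 := is_derive1_powR (r - 1) t0.
apply: is_derive_eq; rewrite /GRing.scale /=.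
have -> : r - 1 - 1 = r - 2 by lra.
have -> : t `^ (r - 1) = t * t `^ (r - 2).
  have -> : r - 1 = 1 + (r - 2) by lra.
  by rewrite (@powRDpos _ t 1)// powRr1 ?(ltW t0).
by ring.
Qed.

Lemma chord_num1 r : chord_num r 1 = 0.
Proof. by rewrite /chord_num !powR1; ring. Qed.

Lemma continuous_chord_num r : {within `]0, 1]%classic, continuous (chord_num r)}.
Proof.
apply: derivable_within_continuous => t; rewrite in_itv/= => /andP[t0 _].
by have [] := is_derive_chord_num r t0.
Qed.

Lemma derive1_chord_num r t : 0 < t -> (chord_num r)^`()%classic t =
   r * (1 - t `^ (r - 2) * (1 + (2 - r) * (t - 1))).
Proof. by move=> t0; rewrite derive1E; have [_] := is_derive_chord_num r t0. Qed.

Lemma chord_num_gt0 r t : 1 < r < 2 -> 0 < t < 1 -> 0 < chord_num r t.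
Proof.
move=> /andP[r1 r2] /andP[t0 t1]; 
suff h : {in `]0, 1]%R &, {homo chord_num r : x y /~ x < y}}.
  by rewrite -[ltLHS](chord_num1 r); apply: h; rewrite ?in_itv/= ?t0 ?ltr01 ?lexx// ltW.
apply: ltr0_derive1_lt_oc.
- by move=> x; rewrite in_itv/= => /andP[x0 _]; have [] := is_derive_chord_num r x0.
- move=> x; rewrite in_itv/= => /andP[x0 x1]; rewrite derive1_chord_num//.
  rewrite pmulr_rlt0; last by lra.
  rewrite subr_lt0 (_ : r - 2 = - (2 - r)); last by lra.
  rewrite powRN mulrC ltr_pdivlMr ?powR_gt0// mul1r.
  by apply: bernoulli_01 => //; [lra|rewrite lt_eqF].
- exact: continuous_chord_num.
Qed.

Lemma chord_num_lt0 r t : 2 < r -> 0 < t < 1 -> chord_num r t < 0.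
Proof.
move=> r2 /andP[t0 t1]; 
suff h : {in `]0, 1]%R &, {homo chord_num r : x y / x < y}}.
  by rewrite -[ltRHS](chord_num1 r); apply: h; rewrite ?in_itv/= ?t0 ?ltr01 ?lexx// ltW.
apply: gtr0_derive1_lt_oc.
- by move=> x; rewrite in_itv/= => /andP[x0 _]; have [] := is_derive_chord_num r x0.
- move=> x; rewrite in_itv/= => /andP[x0 x1]; rewrite derive1_chord_num//.
  rewrite pmulr_rgt0; last by lra.
  rewrite subr_gt0 {1}(_ : r - 2 = - (2 - r)); last by lra.
  rewrite powRN mulrC ltr_pdivrMr ?powR_gt0// mul1r.
  by apply: bernoulli_lt0 => //; [lra|rewrite lt_eqF].
- exact: continuous_chord_num.
Qed.

Definition lnchord r t : R := ln (1 - t `^ r) - (r - 1) * ln (1 + t) - ln (1 - t).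

Lemma chord_expR r t : 0 < r -> 0 <= t < 1 -> chord r t = expR (lnchord r t).
Proof.
move=> r0 t01; have /andP[t0 t1] := t01.
have h1 := powR_lt1 r0 t01.
rewrite /lnchord !expRB !lnK ?posrE ?subr_gt0//.
rewrite -powR_expR; last by lra.
by rewrite /chord invfM mulrA.
Qed.

Lemma is_derive_lnchord r t : 0 < r -> 0 < t < 1 -> is_derive t 1 (lnchord r)
  (chord_num r t / ((1 - t `^ r) * (1 + t) * (1 - t))).
Proof.
move=> r0 /andP[t0 t1]; rewrite /lnchord.
have tr1 : t `^ r < 1 by rewrite powR_lt1// t1 ltW.
have h0 := is_derive1_powR r t0.
have h1 : is_derive t 1 (fun t : R => 1 - t `^ r) (- (r * t `^ (r - 1))).
  by apply: is_derive_eq; ring.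
have h2 : is_derive t 1 (fun t : R => 1 + t) 1.
  by apply: is_derive_eq; ring.
have h3 : is_derive t 1 (fun t : R => 1 - t) (-1).
  by apply: is_derive_eq; ring.
have p1 : 0 < 1 - t `^ r by lra.
have p2 : 0 < 1 + t by lra.
have p3 : 0 < 1 - t by lra.
have k1 := @is_derive1_comp R (@ln R) (fun t : R => 1 - t `^ r) t _ _ (is_derive1_ln p1) h1.
have k2 := @is_derive1_comp R (@ln R) (fun t : R => 1 + t) t _ _ (is_derive1_ln p2) h2.
have k3 := @is_derive1_comp R (@ln R) (fun t : R => 1 - t) t _ _ (is_derive1_ln p3) h3.
apply: (@is_derive_eq _ _ _ (((@ln R) \o (fun t : R => 1 - t `^ r)) -
   (r - 1) \*o ((@ln R) \o (fun t : R => 1 + t)) -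
   ((@ln R) \o (fun t : R => 1 - t)))); rewrite /GRing.scale /=.
have e : t `^ r = t * t `^ (r - 1) by rewrite mulr_powRB1 ?ltW.
rewrite /chord_num; rewrite e in p1 *.
by field; rewrite !gt_eqF.
Qed.

Lemma continuous_lnchord r : 0 < r -> {within `[0, 1[%classic, continuous (lnchord r)}.
Proof.
move=> r0.
apply: (@subspace_eq_continuous _ _ _ (fun t : R =>
  ln (1 - `|t| `^ r) - (r - 1) * ln (1 + t) - ln (1 - t))).
  by move=> t; rewrite inE/= in_itv/= => /andP[t0 _]; rewrite ger0_norm.
apply: continuous_in_subspaceT => t; rewrite inE/= in_itv/= => t01.
have /andP[t0 t1] := t01.
have cl (f : R -> R) : continuous f -> 0 < f t -> {for t, continuous (fun x => ln (f x))}.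
  move=> cf f0; apply: (@continuous_comp _ _ _ f (@ln R)); first exact: cf.
  exact: continuous_ln.
apply: cvgB; first apply: cvgB.
- apply: cl; last by rewrite subr_gt0 ger0_norm// powR_lt1.
  by move=> x; apply: cvgB; [exact: cvg_cst|exact: continuous_powR_norm].
- apply: cvgM; first exact: cvg_cst.
  by apply: cl; [move=> x; apply: cvgD; [exact: cvg_cst|exact: cvg_id]|lra].
- by apply: cl; [move=> x; apply: cvgB; [exact: cvg_cst|exact: cvg_id]|lra].
Qed.

Lemma derive1_lnchord r t : 0 < r -> 0 < t < 1 -> (lnchord r)^`()%classic t =
  chord_num r t / ((1 - t `^ r) * (1 + t) * (1 - t)).
Proof. by move=> r0 t0; rewrite derive1E; have [_] := is_derive_lnchord r0 t0. Qed.

Lemma chord_incr r s t : 1 < r < 2 -> 0 <= s -> s < t -> t < 1 -> chord r s < chord r t.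
Proof.
move=> r12 s0 st t1; have /andP[r1 r2] := r12; have r0 : 0 < r by lra.
rewrite !chord_expR//; [|lra..].
rewrite ltr_expR.
suff h : {in `[0, 1[%R &, {homo lnchord r : x y / x < y}}.
  by apply: h; rewrite ?in_itv//=; lra.
apply: gtr0_derive1_lt_co.
- by move=> x; rewrite in_itv/= => x01; have [] := is_derive_lnchord r0 x01.
- move=> x; rewrite in_itv/= => x01; rewrite derive1_lnchord//; have /andP[x0 x1] := x01.
  have h : x `^ r < 1 by rewrite powR_lt1// x1 ltW.
  by rewrite divr_gt0 ?chord_num_gt0// !mulr_gt0 ?subr_gt0//; lra.
- exact: continuous_lnchord.
Qed.

Lemma chord_decr r s t : 2 < r -> 0 <= s -> s < t -> t < 1 -> chord r t < chord r s.
Proof.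
move=> r2 s0 st t1; have r0 : 0 < r by lra.
rewrite !chord_expR//; [|lra..].
rewrite ltr_expR.
suff h : {in `[0, 1[%R &, {homo lnchord r : x y /~ x < y}}.
  by apply: h; rewrite ?in_itv//=; lra.
apply: ltr0_derive1_lt_co.
- by move=> x; rewrite in_itv/= => x01; have [] := is_derive_lnchord r0 x01.
- move=> x; rewrite in_itv/= => x01; rewrite derive1_lnchord//; have /andP[x0 x1] := x01.
  have h : x `^ r < 1 by rewrite powR_lt1// x1 ltW.
  have d : 0 < (1 - x `^ r) * (1 + x) * (1 - x) by rewrite !mulr_gt0 ?subr_gt0//; lra.
  by rewrite pmulr_llt0 ?invr_gt0// chord_num_lt0.
- exact: continuous_lnchord.
Qed.

Lemma continuous_expR_comp (T : topologicalType) (f : T -> R) :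
  continuous f -> continuous (expR \o f).
Proof. by move=> cf x; apply: continuous_comp; [exact: cf|exact: continuous_expR]. Qed.

Lemma continuous_chord r a : 0 < r -> a < 1 -> {within `[0, a]%classic, continuous (chord r)}.
Proof.
move=> r0 a1; have : {within `[0, 1[%classic, continuous (expR \o lnchord r)}.
  exact: (continuous_expR_comp (@continuous_lnchord r r0)).
move=> /subspace_eq_continuous h.
apply: (@continuous_subspaceW _ _ `[0, a]%classic `[0, 1[%classic).
  by move=> x /=; rewrite !in_itv/=; lra.
apply: (h (chord r)) => x; rewrite inE/= in_itv/= => x01. by rewrite (chord_expR r0 x01).
Qed.

Lemma chord0 r : 0 < r -> chord r 0 = 1.
Proof. by move=> r0; rewrite /chord powR0 ?gt_eqF// addr0 subr0 powR1 mulr1 divr1. Qed.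

Lemma chord_gt0 r t : 0 < r -> 0 <= t < 1 -> 0 < chord r t.
Proof. by move=> r0 t0; rewrite chord_expR// expR_gt0. Qed.

End Chord.

(** * The one-variable inequalities and the numbers t1 and t2 *)

Section OneVariable.
Context {R : realType}.
Implicit Types a b g k r s t u w x y : R.

Definition superadd_ratio r t : R := (1 + t) `^ r / (1 + t `^ r).

Lemma superadd_ratio_ge0 r t : 0 <= superadd_ratio r t.
Proof. by rewrite /superadd_ratio divr_ge0 ?powR_ge0// addr_ge0 ?powR_ge0. Qed.

Lemma superadd_ratio_le_pow r t : superadd_ratio r t <= (1 + t) `^ r.
Proof.
rewrite /superadd_ratio ler_pdivrMr; last by rewrite ltr_pwDl ?powR_ge0.
by rewrite ler_peMr ?powR_ge0// lerDl powR_ge0.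
Qed.

(** Convexity of the r-th power at the midpoint of 1 and t. *)
Lemma superadd_ratio_le_pow2 r t : 1 <= r -> 0 < t -> superadd_ratio r t <= 2 `^ (r - 1).
Proof.
move=> r1 t0; rewrite /superadd_ratio ler_pdivrMr; last by rewrite ltr_pwDl ?powR_ge0.
have h01 : 0 <= (2 : R)^-1 <= 1 by lra.
have := powR_convex r1 h01 ler01 (ltW t0).
have -> : 2^-1 * 1 + (1 - 2^-1) * t = (1 + t) / 2 by lra.
rewrite powRM ?powR1//; [|lra..].
have e1 : 2 `^ r * 2^-1 `^ r = 1 :> R by rewrite -powRM// divff ?powR1.
have e2 : 2 `^ r = 2 * 2 `^ (r - 1) :> R by rewrite mulr_powRB1//; lra.
have e3 := powR_gt0 (r - 1) (ltr0n R 2).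
have e4 : (1 + t) `^ r = 2 * 2 `^ (r - 1) * ((1 + t) `^ r * 2^-1 `^ r).
  by rewrite -e2 mulrCA e1 mulr1.
move=> h; rewrite e4 -subr_ge0; move: h e3.
move: (_ * 2^-1 `^ r) (t `^ r) (2 `^ _) => A B C h C0.
have -> : C * (1 + B) - 2 * C * A = C * (1 + B - 2 * A) by ring.
by rewrite mulr_ge0 ?(ltW C0)//; lra.
Qed.

(** (1 - t^r) / (1 - t) >= 1 + t (1 - t^(r - 1)) >= (1 + t)^(1 - t^(r - 1)),
    the second step being Bernoulli's inequality; the exponent on the right
    is at least k + r - 1. *)
Lemma chord_ge_pow r t k : 1 < r < 2 -> 0 < t < 1 ->
  k <= 2 - r - t `^ (r - 1) -> (1 + t) `^ k <= chord r t.
Proof.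
move=> /andP[r1 r2] /andP[t0 t1] hk.
rewrite /chord ler_pdivlMr; last by rewrite mulr_gt0 ?powR_gt0//; lra.
have t1' : 0 < 1 + t by lra.
rewrite mulrA -powRDpos//.
have P1 : t `^ (r - 1) < 1 by rewrite powR_lt1//; lra.
have P0 := powR_ge0 t (r - 1).
have -> : t `^ r = t * t `^ (r - 1) by rewrite mulr_powRB1 ?(ltW t0)//; lra.
set P := t `^ (r - 1) in hk P0 P1 *.
have h1 : (1 + t) `^ (k + (r - 1)) <= (1 + t) `^ (1 - P).
  by apply: ler_powR; lra.
have h2 : (1 + t) `^ (1 - P) <= 1 + (1 - P) * (1 + t - 1).
  by apply: bernoulli_le1; lra.
apply: (@le_trans _ _ ((1 + (1 - P) * (1 + t - 1)) * (1 - t))).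
  by rewrite ler_wpM2r// ?(le_trans h1 h2)//; lra.
have : t * t * (1 - P) >= 0 by rewrite !mulr_ge0//; lra.
by lra.
Qed.

(** The exponent is a = (C(tau) - 1) / r with C = [chord r]. For t <= tau it is
    small enough for [chord_ge_pow]. For t > tau, C(t) > C(tau) = 1 + r a,
    whereas the left-hand side is at most 2^((r - 1) a) <= r^a <= 1 + r a. *)
Lemma superadd_ratio_le_chord r tau t : 1 < r < 2 -> t1_spec r tau -> 0 < t < 1 ->
  superadd_ratio r t `^ ((2 - r - tau `^ (r - 1)) / r) <= chord r t.
Proof.
move=> r12 [tau01 etau] t01.
have /andP[r1 r2] := r12; have /andP[tau0 tau1] := tau01.
have /andP[t0 t1] := t01.
have r0 : 0 < r by lra.
have ctau : 1 < chord r tau.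
  by rewrite -(@chord0 R r)//; apply: chord_incr.
rewrite -/(chord r tau) in etau.
set a := _ / r.
have ra : r * a = chord r tau - 1 by rewrite -etau /a mulrC divfK// gt_eqF.
have a0 : 0 < a by rewrite -(pmulr_rgt0 _ r0) ra; lra.
have a1 : a <= 1.
  by rewrite /a ler_pdivrMr//; have := powR_ge0 tau (r - 1); lra.
have [tt|tt] := leP t tau.
  apply: (@le_trans _ _ ((1 + t) `^ (r * a))).
    rewrite powRrM powR_le ?(ltW a0) ?superadd_ratio_ge0//; exact: superadd_ratio_le_pow.
  apply: chord_ge_pow => //; rewrite ra -etau lerD2l lerN2.
  by apply: powR_le; lra.
apply: (@le_trans _ _ (r `^ a)).
  apply: powR_le; rewrite ?superadd_ratio_ge0 ?(ltW a0)//.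
  apply: le_trans (superadd_ratio_le_pow2 _ _) _ => //; first lra.
  have : (2 : R) `^ (r - 1) <= 1 + (r - 1) * (2 - 1).
    by apply: bernoulli_le1; lra.
  by lra.
have h1 : r `^ a <= 1 + a * (r - 1) by apply: bernoulli_le1; lra.
have h2 : chord r tau < chord r t by apply: chord_incr => //; lra.
by lra.
Qed.

Lemma invchord_ge_pow r t k : 0 < r -> 0 < t < 1 ->
  1 - t `^ r <= (1 + t) `^ (r - 1 - k) * (1 - t) ->
  (1 + t) `^ k <= (chord r t)^-1.
Proof.
move=> r0 t01 h; have /andP[t0 t1] := t01.
rewrite /chord invf_div ler_pdivlMr ?subr_gt0 ?powR_lt1 ?t1 ?(ltW t0)//.
have -> : r - 1 = k + (r - 1 - k) by lra.
rewrite powRDpos; last lra.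
by rewrite -mulrA ler_wpM2l ?powR_ge0.
Qed.

(** The argument of [superadd_ratio_le_chord] for the reciprocal of the chord.
    Before the root, (1 + t)^(1 + t) (1 - t) >= 1 - t^3 >= 1 - t^r replaces
    [chord_ge_pow]; beyond it, 2^(r - 1) <= r + 1 replaces 2^(r - 1) <= r. *)
Lemma superadd_ratio_le_invchord_23 r tau t : 2 < r < 3 -> t2_spec r tau -> 0 < t < 1 ->
  superadd_ratio r t `^ ((r - 2 - tau) / r) <= (chord r t)^-1.
Proof.
move=> /andP[r2 r3] [tau01 etau] t01.
have /andP[tau0 tau1] := tau01.
have /andP[t0 t1] := t01.
have r0 : 0 < r by lra.
have etau' : r - 2 - tau = (chord r tau)^-1 - 1 by rewrite /chord invf_div.
have ctau : 1 < (chord r tau)^-1.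
  rewrite invf_gt1 ?chord_gt0 ?(ltW tau0)// -[ltRHS](@chord0 R r)//.
  exact: chord_decr.
set a := _ / r.
have ra : r * a = r - 2 - tau by rewrite /a mulrC divfK// gt_eqF.
have a0 : 0 < a by rewrite -(pmulr_rgt0 _ r0) ra; lra.
have a1 : a <= 1 by rewrite /a ler_pdivrMr//; lra.
have [tt|tt] := leP t tau.
  apply: (@le_trans _ _ ((1 + t) `^ (r * a))).
    rewrite powRrM powR_le ?(ltW a0) ?superadd_ratio_ge0//; exact: superadd_ratio_le_pow.
  apply: invchord_ge_pow => //; rewrite ra.
  have h1 : 1 + (1 + t) * (1 + t - 1) <= (1 + t) `^ (1 + t).
    by apply: bernoulli_ge1; lra.
  have h2 : (1 + t) `^ (1 + t) <= (1 + t) `^ (r - 1 - (r - 2 - tau)).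
    by apply: ler_powR; lra.
  have h3 : t `^ 3 <= t `^ r by apply: ger_powR; lra.
  rewrite (@powR_mulrn _ t 3) ?(ltW t0)// in h3.
  apply: (@le_trans _ _ ((1 + (1 + t) * (1 + t - 1)) * (1 - t))).
    have -> : (1 + (1 + t) * (1 + t - 1)) * (1 - t) = 1 - t ^+ 3 by ring.
    by lra.
  by rewrite ler_wpM2r ?(le_trans h1 h2)//; lra.
apply: (@le_trans _ _ ((1 + r) `^ a)).
  apply: powR_le; rewrite ?superadd_ratio_ge0 ?(ltW a0)//.
  apply: le_trans (superadd_ratio_le_pow2 _ _) _ => //; first lra.
  have -> : r - 1 = (r - 2) + 1 by lra.
  rewrite powRDpos// powRr1//.
  have : (2 : R) `^ (r - 2) <= 1 + (r - 2) * (2 - 1).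
    by apply: bernoulli_le1; lra.
  by lra.
have h1 : (1 + r) `^ a <= 1 + a * (1 + r - 1) by apply: bernoulli_le1; lra.
have h2 : (chord r tau)^-1 < (chord r t)^-1.
  by rewrite ltf_pV2 ?posrE ?chord_gt0 ?chord_decr// ?(ltW t0) ?(ltW tau0).
by lra.
Qed.

Lemma ln_ge1V x : 0 < x -> 1 - x^-1 <= ln x.
Proof.
move=> x0; have xi : 0 < x^-1 by rewrite invr_gt0.
have : ln (1 + (x^-1 - 1)) <= x^-1 - 1 by apply: le_ln1Dx; lra.
by rewrite subrKC lnV ?posrE//; lra.
Qed.

(** Carries an estimate of 1 - t^k to larger exponents. The claim says that
    the average of (1 + t)^s and t^s with weights 1 - t^k and t^k is at least
    1; by exp(z) >= 1 + z it is enough that the same average of ln (1 + t)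
    and ln t is nonnegative. *)
Lemma one_sub_pow_shift k s t : 3 <= k -> 0 <= s -> 0 < t < 1 ->
  1 - t `^ (k + s) <= (1 - t `^ k) * (1 + t) `^ s.
Proof.
move=> k3 s0 /andP[t0 t1]; rewrite powRDpos//.
have t1' : 0 < 1 + t by lra.
have T3 : t `^ k <= t ^+ 3.
  by rewrite -(@powR_mulrn _ t 3) ?(ltW t0)//; apply: ger_powR; lra.
have T0 := powR_gt0 k t0.
have T1 : t `^ k < 1 by rewrite powR_lt1//; lra.
rewrite (powR_expR s t0) (powR_expR s t1').
have e1 := expR_ge1Dx (s * ln t).
have e2 := expR_ge1Dx (s * ln (1 + t)).
have l1 := ln_ge1V t0.
have l2 := ln_ge1V t1'.
set T := t `^ k in T0 T1 T3 *.
(* The bound ln x >= 1 - 1 / x reduces this to t^2 >= t^k. *)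
have key : 0 <= (1 - T) * ln (1 + t) + T * ln t.
  apply: (@le_trans _ _ ((1 - T) * (1 - (1 + t)^-1) + T * (1 - t^-1))); last first.
    by apply: lerD; rewrite ler_wpM2l//; lra.
  have -> : (1 - T) * (1 - (1 + t)^-1) + T * (1 - t^-1) =
    ((1 - T) * t * t - T * (1 - t) * (1 + t)) / (t * (1 + t)).
    by field; rewrite !gt_eqF.
  rewrite divr_ge0 ?mulr_ge0 ?(ltW t0) ?(ltW t1')//.
  have -> : (1 - T) * t * t - T * (1 - t) * (1 + t) = t * t - T by ring.
  have : t * t * t <= t * t * 1 by rewrite ler_wpM2l ?mulr_ge0 ?(ltW t0) ?(ltW t1).
  by rewrite !exprS expr0 in T3; lra.
have e3 : (1 - T) * (1 + s * ln (1 + t)) <= (1 - T) * expR (s * ln (1 + t)).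
  by rewrite ler_wpM2l//; lra.
have e4 : T * (1 + s * ln t) <= T * expR (s * ln t).
  by rewrite ler_wpM2l//; lra.
have : 0 <= s * ((1 - T) * ln (1 + t) + T * ln t) by rewrite mulr_ge0.
by lra.
Qed.

(** For r = 3 this is (1 + t + t^2)^3 <= (1 + t)^5. *)
Lemma one_sub_pow_le_3 r t : 3 <= r -> 0 < t < 1 ->
  1 - t `^ r <= (1 + t) `^ (r - 4 / 3) * (1 - t).
Proof.
move=> r3 t01; have /andP[t0 t1] := t01.
have {1}-> : r = 3 + (r - 3) by lra.
have r30 : 0 <= r - 3 by lra.
apply: le_trans (one_sub_pow_shift (lexx 3) r30 t01) _.
have -> : r - 4 / 3 = 5 / 3 + (r - 3) by lra.
rewrite (@powRDpos _ (1 + t) (5 / 3)); last lra.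
rewrite [leRHS]mulrAC ler_wpM2r ?powR_ge0//.
rewrite (@powR_mulrn _ t 3) ?(ltW t0)//.
have -> : 1 - t ^+ 3 = (1 + t + t * t) * (1 - t) by ring.
rewrite ler_wpM2r//; first lra.
set X := (1 + t) `^ (5 / 3).
have X0 : 0 <= X by rewrite powR_ge0.
have X3 : X ^+ 3 = (1 + t) ^+ 5.
  rewrite /X -powR_mulrn ?powR_ge0// -powRrM.
  have -> : 5 / 3 * 3 = 5 :> R by lra.
  by rewrite powR_mulrn//; lra.
have Y0 : 0 <= 1 + t + t * t by rewrite !addr_ge0 ?mulr_ge0// ltW.
rewrite -(@ler_pXn2r _ 3) ?nnegrE// X3 -subr_ge0.
have -> : (1 + t) ^+ 5 - (1 + t + t * t) ^+ 3 =
  t * (2 + 4 * t + 3 * t ^+ 2 - t ^+ 3 - 2 * t ^+ 4 - t ^+ 5) by ring.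
apply: mulr_ge0; first lra.
have h3 : t ^+ 3 <= 1 by rewrite exprn_ile1// ltW.
have h4 : t ^+ 4 <= t ^+ 2 by rewrite ler_wiXn2l// ltW.
have h5 : t ^+ 5 <= 1 by rewrite exprn_ile1// ltW.
have h2 : 0 <= t ^+ 2 by rewrite exprn_ge0// ltW.
by lra.
Qed.

Lemma one_sub_pow_le_4 r t : 4 <= r -> 0 < t < 1 ->
  1 - t `^ r <= (1 + t) `^ (r - 2) * (1 - t).
Proof.
move=> r4 t01; have /andP[t0 t1] := t01.
have {1}-> : r = 4 + (r - 4) by lra.
have r40 : 0 <= r - 4 by lra.
have h34 : (3 : R) <= 4 by lra.
apply: le_trans (one_sub_pow_shift h34 r40 t01) _.
have -> : r - 2 = 2 + (r - 4) by lra.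
rewrite (@powRDpos _ (1 + t) 2); last lra.
rewrite [leRHS]mulrAC ler_wpM2r ?powR_ge0//.
rewrite (@powR_mulrn _ t 4) ?(ltW t0)// (@powR_mulrn _ (1 + t) 2); last lra.
rewrite -subr_ge0.
have -> : (1 + t) ^+ 2 * (1 - t) - (1 - t ^+ 4) = t * (1 - t) * (1 + t) * (1 - t).
  by ring.
by rewrite !mulr_ge0//; lra.
Qed.

(** The left-hand side of the equation decreases in t and the right-hand side
    increases. The left-hand side vanishes at (2 - r)^(1 / (r - 1)), which
    gives the sign change. *)
Lemma t1_exists r : 1 < r < 2 -> exists! t, t1_spec r t.
Proof.
move=> r12; have /andP[r1 r2] := r12; have r0 : 0 < r by lra.
have r10 : 0 < r - 1 by lra.
pose f t : R := chord r t - 1 - (2 - r) + `|t| `^ (r - 1).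
pose tau := (2 - r) `^ (r - 1)^-1.
have tau0 : 0 < tau by rewrite powR_gt0//; lra.
have tau1 : tau < 1 by rewrite powR_lt1 ?invr_gt0//; lra.
have etau : tau `^ (r - 1) = 2 - r.
  by rewrite /tau -powRrM mulVf ?gt_eqF// powRr1//; lra.
have f0 : f 0 < 0 by rewrite /f chord0// normr0 powR0 ?gt_eqF//; lra.
have ftau : 0 < f tau.
  rewrite /f ger0_norm ?(ltW tau0)// etau.
  have : chord r 0 < chord r tau by apply: chord_incr.
  by rewrite chord0//; lra.
have cf : {within `[0, tau], continuous f}.
  move=> x; apply: cvgD; last first.
    by move: x; apply/continuous_subspaceT/continuous_powR_norm.
  apply: cvgB; last exact: cvg_cst.
  by apply: cvgB; [exact: continuous_chord|exact: cvg_cst].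
have [|t] := IVT (ltW tau0) cf (v := 0).
  by rewrite ge_min le_max (ltW f0) (ltW ftau) orbT.
rewrite in_itv/= => /andP[t0 tt] ft.
have {}t0 : 0 < t.
  by rewrite lt_neqAle t0 andbT; apply/eqP => h; rewrite -h in ft; lra.
have tS : t1_spec r t.
  split; first by lra.
  by rewrite /f ger0_norm ?(ltW t0)// in ft; rewrite -/(chord r t); lra.
have uniq x y : x < y -> t1_spec r x -> t1_spec r y -> False.
  move=> xy [x01 ex] [y01 ey]; rewrite -/(chord r x) in ex.
  rewrite -/(chord r y) in ey.
  have h1 : chord r x < chord r y by apply: chord_incr => //; lra.
  have h2 : x `^ (r - 1) < y `^ (r - 1) by apply: powR_lt => //; lra.
  by lra.
exists t; split => // y yS.
have [h|h|//] := ltgtP t y; first by case: (uniq _ _ h tS yS).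
by case: (uniq _ _ h yS tS).
Qed.

(** As for t1, with the sign change at r - 2, where the left-hand side
    vanishes. *)
Lemma t2_exists r : 2 < r < 3 -> exists! t, t2_spec r t.
Proof.
move=> /andP[r2 r3]; have r0 : 0 < r by lra.
pose f t : R := (chord r t)^-1 - 1 - (r - 2) + t.
have E t : 0 < t < 1 -> t2_spec r t <-> f t = 0.
  move=> t01; rewrite /t2_spec /f /chord invf_div; split; first by case=> _; lra.
  by move=> h; split => //; lra.
pose tau := r - 2.
have tau0 : 0 < tau by rewrite /tau; lra.
have tau1 : tau < 1 by rewrite /tau; lra.
have f0 : f 0 < 0 by rewrite /f chord0// invr1; lra.
have incr x y : 0 <= x -> x < y -> y < 1 -> f x < f y.
  move=> x0 xy y1.
  have h : (chord r x)^-1 < (chord r y)^-1.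
    by rewrite ltf_pV2 ?posrE ?chord_gt0 ?chord_decr//; lra.
  by rewrite /f; lra.
have ftau : 0 < f tau.
  have : (chord r 0)^-1 < (chord r tau)^-1.
    by rewrite ltf_pV2 ?posrE ?chord_gt0 ?chord_decr//; lra.
  by rewrite chord0// invr1 /f /tau; lra.
have cf : {within `[0, tau], continuous f}.
  rewrite continuous_subspace_in => x; rewrite inE/= in_itv/= => x0.
  apply: cvgD; last first.
    by move: x {x0}; apply/continuous_subspaceT => x; exact: cvg_id.
  apply: cvgB; last exact: cvg_cst.
  apply: cvgB; last exact: cvg_cst.
  by apply: cvgV; [rewrite gt_eqF// chord_gt0//; lra|exact: continuous_chord].
have [|t] := IVT (ltW tau0) cf (v := 0).
  by rewrite ge_min le_max (ltW f0) (ltW ftau) orbT.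
rewrite in_itv/= => /andP[t0 tt] ft.
have {}t0 : 0 < t.
  by rewrite lt_neqAle t0 andbT; apply/eqP => h; rewrite -h in ft; lra.
have t01 : 0 < t < 1 by lra.
exists t; split; first exact/E.
move=> y yS; have y01 := yS.1; move: yS => /(E _ y01) yS.
have [h|h|//] := ltgtP t y.
  have : f t < f y by apply: incr; lra.
  by rewrite ft yS ltxx.
have : f y < f t by apply: incr; lra.
by rewrite ft yS ltxx.
Qed.

Lemma t1P r : 1 < r < 2 -> t1_spec r (t1 r).
Proof.
move=> /t1_exists[t [h _]].
exact: (@xgetPex _ 0 [set t | t1_spec r t] (ex_intro _ t h)).
Qed.

Lemma t2P r : 2 < r < 3 -> t2_spec r (t2 r).
Proof.
move=> /t2_exists[t [h _]].
exact: (@xgetPex _ 0 [set t | t2_spec r t] (ex_intro _ t h)).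
Qed.

Lemma a1_gt0 r : 1 < r < 2 -> 0 < a1 r.
Proof.
move=> r12; have [t01 e] := t1P r12; have /andP[r1 r2] := r12.
rewrite /a1 divr_gt0//; last lra.
rewrite e -/(chord r (t1 r)).
have : chord r 0 < chord r (t1 r) by apply: chord_incr => //; lra.
by rewrite chord0; lra.
Qed.

Lemma a2_gt0 r : 2 < r < 3 -> 0 < a2 r.
Proof.
move=> r12; have [t01 e] := t2P r12; have /andP[r1 r2] := r12.
have r0 : 0 < r by lra.
rewrite /a2 divr_gt0//.
rewrite e -[_ / _]invf_div -/(chord r (t2 r)).
have : (chord r 0)^-1 < (chord r (t2 r))^-1.
  by rewrite ltf_pV2 ?posrE ?chord_gt0 ?chord_decr//; lra.
by rewrite chord0// invr1; lra.
Qed.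

(** The lower bound makes r alpha - 1 nonnegative, which [two_point_lower]
    needs. *)
Lemma alpha_bound_le1 r : 2 < r -> r^-1 <= alpha_bound r <= 1.
Proof.
move=> r2; have r0 : 0 < r by lra.
suff : 0 <= r * (1 - alpha_bound r) <= r - 1.
  rewrite pmulr_rge0// => /andP[h1 h2]; apply/andP; split; last lra.
  by rewrite -(ler_pM2l r0) divff ?gt_eqF//; lra.
rewrite /alpha_bound; have [r3|r3] := ltP.
  have r23 : 2 < r < 3 by lra.
  have h0 := a2_gt0 r23; have [t01 _] := t2P r23.
  have -> : r * (1 - (1 - a2 r)) = r * a2 r by ring.
  rewrite mulr_ge0 ?(ltW h0) ?(ltW r0)//= /a2 mulrC divfK ?gt_eqF//; lra.
have [r4|r4] := ltP.
  have -> : r * (1 - (1 - 1 / (3 * r))) = 1 / 3 by field; rewrite gt_eqF.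
  by lra.
have -> : r * (1 - (1 - (r - 2) / r ^+ 2)) = (r - 2) / r by field; rewrite gt_eqF.
rewrite divr_ge0//=; [|lra..].
by rewrite ler_pdivrMr//; nra.
Qed.

Lemma superadd_ratio_le_invchord r t : 2 < r -> 0 < t < 1 ->
  superadd_ratio r t `^ (1 - alpha_bound r) <= (chord r t)^-1.
Proof.
move=> r2 t01; have r0 : 0 < r by lra.
have /andP[t0 t1] := t01.
have ab : 0 <= 1 - alpha_bound r by have := alpha_bound_le1 r2; lra.
have [r3|r3] := ltP r 3.
  rewrite /alpha_bound r3 opprB addrC subrK /a2.
  by apply: superadd_ratio_le_invchord_23 => //; [lra|apply: t2P; lra].
apply: (@le_trans _ _ ((1 + t) `^ (r * (1 - alpha_bound r)))).
  by rewrite powRrM powR_le ?superadd_ratio_ge0// superadd_ratio_le_pow.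
apply: invchord_ge_pow => //.
rewrite /alpha_bound ltNge r3/=; have [r4|r4] := ltP.
  have -> : r * (1 - (1 - 1 / (3 * r))) = 1 / 3 by field; rewrite gt_eqF.
  have -> : r - 1 - 1 / 3 = r - 4 / 3 by lra.
  exact: one_sub_pow_le_3.
apply: le_trans (one_sub_pow_le_4 r4 t01) _.
rewrite ler_wpM2r//; first lra.
have -> : r * (1 - (1 - (r - 2) / r ^+ 2)) = (r - 2) / r by field; rewrite gt_eqF.
apply: ler_powR; first lra.
have : (r - 2) / r <= 1 by rewrite ler_pdivrMr//; lra.
by lra.
Qed.

End OneVariable.

(** * Extrema on the simplex *)

Section Simplex.
Context {R : realType} {n : nat}.
Implicit Types (q y z : 'I_n -> R) (c r al s : R).

(** With y_i = x_i^(1/r), the constraint normalizes the power mean of order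
    1 / r of the x_i to 1. *)
Definition simplex q y := (forall i, 0 <= y i) /\ \sum_i q i * y i = 1.

(** The absolute value is there for continuity on the whole space. *)
Definition psum q r y : R := \sum_i q i * `|y i| `^ r.

Definition wprod q r y : R := \prod_i `|y i| `^ (q i * r).

Definition mixed q c r al y : R :=
  c * psum q r y `^ al + (1 - c) * wprod q (r * al) y.

Lemma psum_ge0 q r y : (forall i, 0 < q i) -> 0 <= psum q r y.
Proof.
by move=> q0; apply: sumr_ge0 => i _; rewrite mulr_ge0 ?powR_ge0 ?(ltW (q0 i)).
Qed.

Lemma continuous_wsum (T : topologicalType) (q : 'I_n -> R) (g : 'I_n -> T -> R) :
  (forall i, continuous (g i)) -> continuous (fun x => \sum_i q i * g i x).
Proof.
move=> cg; apply: (@continuous_big _ _ +%R 0 xpredT _ _ _ (fun i x => q i * g i x)).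
  exact: add_continuous.
by move=> i _ x; apply: cvgM; [exact: cvg_cst|exact: cg].
Qed.

Lemma continuous_opp (T : topologicalType) (g : T -> R) :
  continuous g -> continuous (fun x => - g x).
Proof. by move=> cg x; apply: cvgN; exact: cg. Qed.

Lemma continuous_combine (T : topologicalType) (c d : R) (f g : T -> R) :
  continuous f -> continuous g -> continuous (fun x => c * f x + d * g x).
Proof.
move=> cf cg x; apply: cvgD.
  by apply: cvgM; [exact: cvg_cst|exact: cf].
by apply: cvgM; [exact: cvg_cst|exact: cg].
Qed.

Lemma continuous_mixed (T : topologicalType) q c r al (g : 'I_n -> T -> R) :
  (forall i, 0 < q i) -> 0 < r -> 0 < al -> (forall i, continuous (g i)) ->
  continuous (fun x => mixed q c r al (g ^~ x)).
Proof.
move=> q0 r0 al0 cg; rewrite /mixed.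
have cp i p : 0 < p -> continuous (fun x => `|g i x| `^ p).
  move=> p0 x; apply: (@continuous_comp _ _ _ (g i) (fun x : R => `|x| `^ p)).
    exact: cg.
  exact: continuous_powR_norm.
have c1 : continuous (fun x => psum q r (g ^~ x) `^ al).
  have -> : (fun x => psum q r (g ^~ x) `^ al) =
            (fun x : R => `|x| `^ al) \o (fun x => psum q r (g ^~ x)).
    by apply/funext => x /=; rewrite ger0_norm// psum_ge0.
  move=> x; apply: (@continuous_comp _ _ _ _ (fun x : R => `|x| `^ al)).
    by apply: continuous_wsum => i; exact: cp.
  exact: continuous_powR_norm.
have c2 : continuous (fun x => wprod q (r * al) (g ^~ x)).
  rewrite /wprod; apply: (@continuous_big R _ *%R 1 xpredT _ _ _
      (fun i x => `|g i x| `^ (q i * (r * al)))).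
    exact: mul_continuous.
  by move=> i _ x; apply: cp; rewrite !mulr_gt0.
by apply: continuous_combine.
Qed.

Lemma simplex_max q (f : ('I_n -> R) -> R) :
  (forall i, 0 < q i) -> \sum_i q i = 1 ->
  continuous (fun v : 'rV[R]_n => f (v ord0)) ->
  exists2 y, simplex q y & forall z, simplex q z -> f z <= f y.
Proof.
move=> q0 q1 cf.
pose S := [set v : 'rV[R]_n | forall i, `[0, (q i)^-1]%classic (v ord0 i)] `&`
          (fun v : 'rV[R]_n => \sum_i q i * v ord0 i) @^-1` [set 1].
have SE (v : 'rV[R]_n) : v \in S <-> simplex q (v ord0).
  rewrite inE /S /=; split=> [[h1 h2]|[h1 h2]]; split => // i.
    by have := h1 i; rewrite /= in_itv/= => /andP[].
  rewrite /= in_itv/= h1/= -[leRHS]mul1r ler_pdivlMr// -h2 mulrC.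
  rewrite (bigD1 i)//= lerDl sumr_ge0// => j _.
  by rewrite mulr_ge0 ?(ltW (q0 j)).
have S0 : S !=set0.
  exists (const_mx 1); apply/set_mem/SE; split => [i|]; first by rewrite mxE.
  by under eq_bigr do rewrite mxE mulr1.
have cS : compact S.
  apply: compact_closedI.
    apply: (@rV_compact R n (fun i => `[0, (q i)^-1]%classic)) => i.
    exact: segment_compact.
  apply: (@preimage_closed _ R); last exact: closed_eq.
  by move=> v _; apply: continuous_wsum => i; exact: coord_continuous.
have [v /SE vS vmax] := EVT_max_rV S0 cS (continuous_subspaceT cf).
exists (v ord0) => // z zS.
have zE : (\row_i z i) ord0 = z by apply/funext => i; rewrite mxE.
by rewrite -zE; apply: vmax; apply/SE; rewrite zE.
Qed.

Lemma simplex_min q (f : ('I_n -> R) -> R) :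
  (forall i, 0 < q i) -> \sum_i q i = 1 ->
  continuous (fun v : 'rV[R]_n => f (v ord0)) ->
  exists2 y, simplex q y & forall z, simplex q z -> f y <= f z.
Proof.
move=> q0 q1 cf.
have [|y yS ymax] := @simplex_max q (fun y => - f y) q0 q1.
  by apply: continuous_opp.
by exists y => // z zS; rewrite -lerN2 ymax.
Qed.

End Simplex.

Section Shift.
Context {R : realType}.
Implicit Types (a b c d k r al s : R).

Lemma is_derive_exchange (qi qj yi yj r al c K C s : R) :
  0 < qi -> 0 < qj -> 0 < yi + s / qi -> 0 < yj - s / qj ->
  0 < K + qi * (yi + s / qi) `^ r + qj * (yj - s / qj) `^ r ->
  is_derive s 1 (fun s => c * (K + qi * (yi + s / qi) `^ r +
     qj * (yj - s / qj) `^ r) `^ al +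
     C * ((yi + s / qi) `^ (qi * (r * al)) * (yj - s / qj) `^ (qj * (r * al))))
  (al * r * (c * (K + qi * (yi + s / qi) `^ r +
       qj * (yj - s / qj) `^ r) `^ (al - 1) *
       ((yi + s / qi) `^ (r - 1) - (yj - s / qj) `^ (r - 1)) +
     C * ((yi + s / qi) `^ (qi * (r * al)) * (yj - s / qj) `^ (qj * (r * al))) *
       ((yi + s / qi)^-1 - (yj - s / qj)^-1))).
Proof.
move=> qi0 qj0 U0 V0 P0.
have dU : is_derive s 1 (fun s => yi + s / qi) qi^-1.
  by apply: is_derive_eq; rewrite /GRing.scale /=; ring.
have dV : is_derive s 1 (fun s => yj - s / qj) (- qj^-1).
  by apply: is_derive_eq; rewrite /GRing.scale /=; ring.
have pU p := @is_derive1_comp R (@powR R ^~ p) _ s _ _ (is_derive1_powR p U0) dU.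
have pV p := @is_derive1_comp R (@powR R ^~ p) _ s _ _ (is_derive1_powR p V0) dV.
have dP : is_derive s 1 (fun s => K + qi * (yi + s / qi) `^ r +
     qj * (yj - s / qj) `^ r)
    (r * ((yi + s / qi) `^ (r - 1) - (yj - s / qj) `^ (r - 1))).
  have h1 := pU r; have h2 := pV r.
  apply: (@is_derive_eq _ _ _ ((cst K + qi \*o ((@powR R ^~ r) \o (fun s => yi + s / qi)))
    + qj \*o ((@powR R ^~ r) \o (fun s => yj - s / qj)))).
  rewrite /GRing.scale /=.
  by field; rewrite !gt_eqF.
have pP := @is_derive1_comp R (@powR R ^~ al) _ s _ _ (is_derive1_powR al P0) dP.
have pUi := pU (qi * (r * al)); have pVj := pV (qj * (r * al)).
apply: (@is_derive_eq _ _ _ (c \*o ((@powR R ^~ al) \o (fun s => K + qi * (yi + s / qi) `^ r +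
     qj * (yj - s / qj) `^ r)) +
  C \*o (((@powR R ^~ (qi * (r * al))) \o (fun s => yi + s / qi)) *
    ((@powR R ^~ (qj * (r * al))) \o (fun s => yj - s / qj))))).
rewrite /GRing.scale /=.
have dm x p : 0 < x -> x `^ (p - 1) = x `^ p / x :> R.
  by move=> x0; rewrite powRDpos// powRN powRr1// ltW.
rewrite (dm _ (qi * (r * al)) U0) (dm _ (qj * (r * al)) V0).
move: U0 V0 => /lt0r_neq0 + /lt0r_neq0.
move: (yi + s / qi) (yj - s / qj) => U V U1 V1.
by field; rewrite U1 V1 !gt_eqF.
Qed.

End Shift.

Section CriticalPoint.
Context {R : realType} {n : nat}.
Implicit Types (q y z : 'I_n -> R) (c r al s : R).

(** The divisions by the weights keep the weighted sum fixed. *)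
Definition exchange q y i j s : 'I_n -> R := fun k =>
  if k == i then y i + s / q i else if k == j then y j - s / q j else y k.

Lemma simplex_exchange q y i j s : (forall k, 0 < q k) -> i != j ->
  simplex q y -> 0 <= y i + s / q i -> 0 <= y j - s / q j ->
  simplex q (exchange q y i j s).
Proof.
move=> q0 ij [y0 y1] hi hj; split => [k|].
  by rewrite /exchange; do 2 case: ifP => // _.
rewrite -y1 (bigD1 i)//= (bigD1 j) 1?eq_sym//=.
rewrite [RHS](bigD1 i)//= [X in _ = _ + X](bigD1 j) 1?eq_sym//=.
rewrite {1 2}/exchange eqxx (negbTE (_ : j != i)) 1?eq_sym// eqxx.
rewrite !addrA; congr (_ + _).
  by field; rewrite !gt_eqF.
by apply: eq_bigr => k /andP[ki kj]; rewrite /exchange (negbTE ki) (negbTE kj).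
Qed.

Lemma mixed_exchange q c r al y i j s : i != j -> (forall k, 0 <= y k) ->
  0 < y i + s / q i -> 0 < y j - s / q j ->
  mixed q c r al (exchange q y i j s) =
  c * (\sum_(k | (k != i) && (k != j)) q k * `|y k| `^ r +
        q i * (y i + s / q i) `^ r + q j * (y j - s / q j) `^ r) `^ al +
  (1 - c) * \prod_(k | (k != i) && (k != j)) `|y k| `^ (q k * (r * al)) *
   ((y i + s / q i) `^ (q i * (r * al)) * (y j - s / q j) `^ (q j * (r * al))).
Proof.
move=> ij y0 hi hj; have ji : j != i by rewrite eq_sym.
have ei : exchange q y i j s i = y i + s / q i by rewrite /exchange eqxx.
have ej : exchange q y i j s j = y j - s / q j.
  by rewrite /exchange (negbTE ji) eqxx.
have ek k : (k != i) && (k != j) -> exchange q y i j s k = y k.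
  by move=> /andP[ki kj]; rewrite /exchange (negbTE ki) (negbTE kj).
rewrite /mixed /psum /wprod (bigD1 i)//= (bigD1 j)//=.
rewrite [X in _ + (1 - c) * X](bigD1 i)//= [X in _ + (1 - c) * (_ * X)](bigD1 j)//=.
rewrite ei ej !gtr0_norm//.
under eq_bigr => k hk do rewrite ek//.
under [X in _ + (1 - c) * (_ * (_ * X))]eq_bigr => k hk do rewrite ek//.
congr (c * _ `^ _ + _); first by ring.
by ring.
Qed.

(** The extremum is compared with the points obtained from it by [exchange];
    the derivative along this segment vanishes at the extremum. *)
Lemma mixed_critical q c r al y :
  (forall k, 0 < q k) -> simplex q y -> (forall k, 0 < y k) ->
  0 < r -> 0 < al ->
  (forall z, simplex q z -> mixed q c r al z <= mixed q c r al y) \/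
  (forall z, simplex q z -> mixed q c r al y <= mixed q c r al z) ->
  forall i j,
  c * psum q r y `^ (al - 1) * y i `^ (r - 1) +
    (1 - c) * wprod q (r * al) y * (y i)^-1 =
  c * psum q r y `^ (al - 1) * y j `^ (r - 1) +
    (1 - c) * wprod q (r * al) y * (y j)^-1.
Proof.
move=> q0 yS yp r0 al0 ext i j.
have [->//|ij] := eqVneq i j; have ji : j != i by rewrite eq_sym.
have y0 k := ltW (yp k).
set K := \sum_(k | (k != i) && (k != j)) q k * `|y k| `^ r.
set C := \prod_(k | (k != i) && (k != j)) `|y k| `^ (q k * (r * al)).
have K0 : 0 <= K.
  by apply: sumr_ge0 => k _; rewrite mulr_ge0 ?powR_ge0 ?(ltW (q0 k)).
pose phi s := c * (K + q i * (y i + s / q i) `^ r + q j * (y j - s / q j) `^ r) `^ al +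
  (1 - c) * C * ((y i + s / q i) `^ (q i * (r * al)) * (y j - s / q j) `^ (q j * (r * al))).
pose a := - (q i * y i); pose b := q j * y j.
have a0 : a < 0 by rewrite oppr_lt0 mulr_gt0.
have b0 : 0 < b by rewrite mulr_gt0.
have pos s : s \in `]a, b[ -> 0 < y i + s / q i /\ 0 < y j - s / q j.
  rewrite in_itv/= => /andP[sa sb]; split.
    have -> : y i + s / q i = (s - a) / q i by rewrite /a; field; rewrite gt_eqF.
    by rewrite divr_gt0// subr_gt0.
  have -> : y j - s / q j = (b - s) / q j by rewrite /b; field; rewrite gt_eqF.
  by rewrite divr_gt0// subr_gt0.
have phiE s : s \in `]a, b[ -> phi s = mixed q c r al (exchange q y i j s).
  by move=> /pos[hi hj]; rewrite mixed_exchange.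
have zin : 0 \in `]a, b[ by rewrite in_itv/= a0 b0.
have e0 : exchange q y i j 0 = y.
  apply/funext => k; rewrite /exchange !mul0r addr0 subr0.
  by case: eqP => [->//|_]; case: eqP => [->|].
have exS s : s \in `]a, b[ -> simplex q (exchange q y i j s).
  by move=> /pos[hi hj]; apply: simplex_exchange => //; exact: ltW.
have dphi s (sab : s \in `]a, b[) := @is_derive_exchange R (q i) (q j) (y i) (y j)
  r al c K ((1 - c) * C) s (q0 i) (q0 j) (pos s sab).1 (pos s sab).2.
have Ppos s : s \in `]a, b[ ->
    0 < K + q i * (y i + s / q i) `^ r + q j * (y j - s / q j) `^ r.
  move=> /pos[hi hj].
  by rewrite -addrA ltr_wpDl// addr_gt0// mulr_gt0// powR_gt0.
have dph s : s \in `]a, b[ -> derivable phi s (1 : R).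
  by move=> sab; have [] := dphi s sab (Ppos s sab).
have d0 : is_derive (0 : R) (1 : R) phi 0.
  case: ext => ext.
    apply: (@derive1_at_max _ phi a b) => //; first by lra.
    by move=> t tab; rewrite !phiE// e0; apply: ext; exact: exS.
  apply: (@derive1_at_min _ phi a b) => //; first by lra.
  by move=> t tab; rewrite !phiE// e0; apply: ext; exact: exS.
have [_ v1] := dphi 0 zin (Ppos 0 zin).
have [_ v2] := d0.
move: v1; rewrite -/phi v2.
have eP : K + q i * (y i + 0 / q i) `^ r + q j * (y j - 0 / q j) `^ r = psum q r y.
  rewrite !mul0r addr0 subr0 /psum (bigD1 i)//= (bigD1 j)//= !gtr0_norm// -/K.
  by ring.
have eC : (1 - c) * C * ((y i + 0 / q i) `^ (q i * (r * al)) *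
   (y j - 0 / q j) `^ (q j * (r * al))) = (1 - c) * wprod q (r * al) y.
  rewrite !mul0r addr0 subr0 /wprod (bigD1 i)//= (bigD1 j)//= !gtr0_norm// -/C.
  by ring.
rewrite eP eC !mul0r addr0 subr0 => /esym/eqP.
rewrite mulf_eq0 gt_eqF ?mulr_gt0//= => /eqP h.
apply/eqP; rewrite -subr_eq0 -h; apply/eqP; ring.
Qed.

End CriticalPoint.

(** * Two-point inequalities and bounds on the simplex *)

Section TwoPoint.
Context {R : realType}.
Implicit Types (a r x y px py P Q al A : R).

(** Homogeneity: the slope of the r-th power between x and y depends on the
    quotient x / y through [chord]. *)
Lemma slopeE r x y : 0 < x < y ->
  (y `^ r - x `^ r) / (y - x) = chord r (x / y) * (x + y) `^ (r - 1).
Proof.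
move=> /andP[x0 xy]; have y0 : 0 < y by lra.
set t := x / y.
have t0 : 0 < t by rewrite divr_gt0.
have t1 : t < 1 by rewrite /t ltr_pdivrMr// mul1r.
have xE : x = t * y by rewrite /t divfK// gt_eqF.
clearbody t; rewrite xE {xE}.
have -> : t * y + y = (1 + t) * y by ring.
have t1' : 0 < 1 + t by lra.
rewrite !powRM ?(ltW t0) ?(ltW y0) ?(ltW t1')// /chord.
have -> : y `^ r = y * y `^ (r - 1).
  by rewrite -{2}(powRr1 (ltW y0)) -powRDpos// subrKC.
have h : (1 + t) `^ (r - 1) != 0 by rewrite gt_eqF// powR_gt0.
field.
have -> : y - t * y = (1 - t) * y by ring.
by rewrite h mulf_neq0 ?(gt_eqF y0)//= subr_eq0 gt_eqF.
Qed.

Lemma superadd_ratioE r x y : 0 < x < y ->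
  superadd_ratio r (x / y) = (x + y) `^ r / (x `^ r + y `^ r).
Proof.
move=> /andP[x0 xy]; have y0 : 0 < y by lra.
set t := x / y.
have t0 : 0 < t by rewrite divr_gt0.
have xE : x = t * y by rewrite /t divfK// gt_eqF.
clearbody t; rewrite xE {xE}.
have -> : t * y + y = (1 + t) * y by ring.
have t1' : 0 < 1 + t by lra.
rewrite !powRM ?(ltW t0) ?(ltW y0) ?(ltW t1')// /superadd_ratio.
have -> : t `^ r * y `^ r + y `^ r = (1 + t `^ r) * y `^ r by ring.
have h1 : y `^ r != 0 by rewrite gt_eqF// powR_gt0.
have h2 : 1 + t `^ r != 0 by rewrite gt_eqF// ltr_pwDl// powR_ge0.
by field; rewrite h1 h2.
Qed.

(** Write m = 1 for the weighted sum, A for that of the r-th powers, T = x + y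
    and S = x^r + y^r. The slope is at least T^(r - 1) (T^r / S)^a by
    hypothesis, so the product is at least (P T)^(r - 1) times the a-th power
    of P^(r - 1) A T^r / S. The first factor is at least 1 since m <= P T, the
    second by [superadd_ratio_weights]. *)
Lemma two_point_upper r a x y px py P : 1 < r -> 0 <= a ->
  (forall t, 0 < t < 1 -> superadd_ratio r t `^ a <= chord r t) ->
  0 < x < y -> 0 < px <= P -> 0 < py <= P -> px * x + py * y = 1 ->
  1 <= P `^ ((1 + a) * (r - 1)) * (px * x `^ r + py * y `^ r) `^ a *
       ((y `^ r - x `^ r) / (y - x)).
Proof.
move=> r1 a0 half xy /andP[px0 pxP] /andP[py0 pyP] m1.
have /andP[x0 xy'] := xy; have y0 : 0 < y by lra.
have P0 : 0 < P by lra.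
rewrite slopeE//.
have t01 : 0 < x / y < 1 by rewrite divr_gt0//= ltr_pdivrMr// mul1r.
have := half _ t01; rewrite superadd_ratioE// => hh.
set S := x `^ r + y `^ r in hh *; set T := x + y in hh *.
set A := px * _ + _.
have X0 := powR_gt0 r x0; have Y0 := powR_gt0 r y0.
have S0 : 0 < S by rewrite addr_gt0.
have T0 : 0 < T by rewrite addr_gt0.
have A0 : 0 < A by rewrite addr_gt0// mulr_gt0.
have TR0 : 0 < T `^ r by rewrite powR_gt0.
(* Either weight may be the larger one, so both orders of x and y occur. *)
have key1 : S <= T `^ r * (P `^ (r - 1) * A).
  have r1' : 1 <= r by exact: ltW.
  have PP p : 0 < p -> p <= P -> T `^ r * (p `^ (r - 1) * A) <= T `^ r * (P `^ (r - 1) * A).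
    move=> p0 pP; rewrite ler_pM2l// ler_pM2r// powR_le ?(ltW p0)//.
    by rewrite subr_ge0.
  have [pp|pp] := leP px py.
    have pp' : 0 < px <= py by rewrite px0.
    have := superadd_ratio_weights r1' y0 x0 pp'.
    rewrite (addrC (py * y)) m1 powR1 mul1r (addrC y x) (addrC (y `^ r)).
    rewrite (addrC (py * y `^ r)) -/T -/S -/A => h.
    exact: le_trans h (PP _ py0 pyP).
  have pp' : 0 < py <= px by rewrite py0 ltW.
  have := superadd_ratio_weights r1' x0 y0 pp'.
  rewrite m1 powR1 mul1r -/T -/S -/A => h.
  exact: le_trans h (PP _ px0 pxP).
have key2 : 1 <= P * T.
  by rewrite -m1 /T mulrDr; apply: lerD; rewrite ler_pM2r.
have -> : (1 + a) * (r - 1) = (r - 1) + (r - 1) * a by ring.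
rewrite (powRDpos _ _ P0) powRrM.
apply: (@le_trans _ _ ((P * T) `^ (r - 1) * (P `^ (r - 1) * A * (T `^ r / S)) `^ a)).
  rewrite -[leLHS]mul1r; apply: ler_pM => //; first by apply: powR_ge1; lra.
  apply: powR_ge1 => //; rewrite mulrA ler_pdivlMr// mul1r.
  by rewrite mulrC.
rewrite powRM ?(ltW P0) ?(ltW T0)//.
rewrite powRM ?divr_ge0 ?mulr_ge0 ?powR_ge0 ?(ltW A0) ?(ltW S0)//.
rewrite powRM ?powR_ge0 ?(ltW A0)//.
have -> : P `^ (r - 1) * (P `^ (r - 1)) `^ a * A `^ a * (chord r (x / y) * T `^ (r - 1)) =
  P `^ (r - 1) * T `^ (r - 1) * (P `^ (r - 1) `^ a * A `^ a * chord r (x / y)) by ring.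
rewrite ler_wpM2l ?mulr_ge0 ?powR_ge0//.
by rewrite ler_wpM2l ?mulr_ge0 ?powR_ge0.
Qed.

(** With T = x + y and S = x^r + y^r, the bounds A >= Q S and
    slope <= T^(r - 1) (S / T^r)^a make all powers of S cancel, leaving
    (Q T)^(r (1 - a) - 1). *)
Lemma two_point_lower r a x y Q A : 1 < r -> 0 <= a -> 1 <= r * (1 - a) ->
  (forall t, 0 < t < 1 -> superadd_ratio r t `^ a <= (chord r t)^-1) ->
  0 < x < y -> 0 < Q -> Q * (x + y) <= 1 -> Q * (x `^ r + y `^ r) <= A ->
  Q `^ ((1 - a) * (r - 1)) * A `^ (- a) * ((y `^ r - x `^ r) / (y - x)) <= 1.
Proof.
move=> r1 a0 ra half xy Q0 QT QA.
have /andP[x0 xy'] := xy; have y0 : 0 < y by lra.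
rewrite slopeE//.
have t01 : 0 < x / y < 1 by rewrite divr_gt0//= ltr_pdivrMr// mul1r.
have c0 : 0 < chord r (x / y).
  by apply: chord_gt0; [lra|case/andP: t01 => /ltW -> ->].
have := half _ t01; rewrite superadd_ratioE// => hh.
set S := x `^ r + y `^ r in hh QA *; set T := x + y in hh QT *.
have X0 := powR_gt0 r x0; have Y0 := powR_gt0 r y0.
have S0 : 0 < S by rewrite addr_gt0.
have T0 : 0 < T by rewrite addr_gt0.
have TR0 : 0 < T `^ r by rewrite powR_gt0.
have h1 : A `^ (- a) <= ((Q * S) `^ a)^-1.
  rewrite powRN lef_pV2 ?posrE ?powR_gt0 ?mulr_gt0//; last first.
    by apply: lt_le_trans QA; rewrite mulr_gt0.
  by rewrite powR_le// mulr_ge0 ?(ltW Q0) ?(ltW S0).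
have h2 : chord r (x / y) <= ((T `^ r / S) `^ a)^-1.
  by rewrite -[leLHS]invrK lef_pV2 ?posrE ?invr_gt0// powR_gt0// divr_gt0.
apply: (@le_trans _ _ (Q `^ ((1 - a) * (r - 1)) * ((Q * S) `^ a)^-1 *
   (((T `^ r / S) `^ a)^-1 * T `^ (r - 1)))).
  apply: ler_pM.
  - by rewrite mulr_ge0 ?powR_ge0.
  - by apply: mulr_ge0; [exact: ltW|exact: powR_ge0].
  - by rewrite ler_wpM2l ?powR_ge0.
  - by rewrite ler_wpM2r ?powR_ge0.
have -> : (1 - a) * (r - 1) = (r * (1 - a) - 1) + a by ring.
have -> : r - 1 = (r * (1 - a) - 1) + r * a by ring.
rewrite (powRDpos _ _ Q0) (powRDpos _ _ T0) !powRM ?invr_ge0 ?(ltW Q0) ?(ltW S0) ?(ltW TR0)//.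
rewrite -powRrM.
have Si : S^-1 `^ a = (S `^ a)^-1 by rewrite -powR_inv1 ?(ltW S0)// -powRrM mulN1r powRN.
rewrite Si.
have q1 : Q `^ a != 0 by rewrite gt_eqF// powR_gt0.
have q2 : S `^ a != 0 by rewrite gt_eqF// powR_gt0.
have q3 : T `^ (r * a) != 0 by rewrite gt_eqF// powR_gt0.
set e := r * (1 - a) - 1.
have -> : Q `^ e * Q `^ a / (Q `^ a * S `^ a) *
   ((T `^ (r * a) / S `^ a)^-1 * (T `^ e * T `^ (r * a))) = Q `^ e * T `^ e.
  by field; rewrite q1 q2 q3.
rewrite -powRM ?(ltW Q0) ?(ltW T0)//.
have e0 : 0 <= e by rewrite /e; lra.
have QT0 : 0 <= Q * T by rewrite mulr_ge0 ?(ltW Q0) ?(ltW T0).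
by have := powR_le e0 QT0 QT; rewrite powR1.
Qed.

End TwoPoint.

Section Bounds.
Context {R : realType} {n : nat}.
Implicit Types (q y z : 'I_n -> R) (c r al a P Q : R).

(** The coordinates other than k have total weight at most P and weighted sum
    1. Jensen's inequality for them is obtained by summing tangents at 1 / P. *)
Lemma face_lower_bound q y r P k : 1 < r -> (forall i, 0 < q i) ->
  \sum_i q i = 1 -> simplex q y -> y k = 0 -> 0 < P -> 1 - q k <= P ->
  1 <= P `^ (r - 1) * psum q r y.
Proof.
move=> r1 q0 q1 [y0 y1] yk P0 qP.
pose mu := P^-1; have mu0 : 0 < mu by rewrite invr_gt0.
have Pmu : P * mu = 1 by rewrite divff// gt_eqF.
have r0 : r != 0 by rewrite gt_eqF//; lra.
rewrite /psum (bigD1 k)//= yk normr0 powR0// mulr0 add0r.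
have e1 : \sum_(i | i != k) q i = 1 - q k.
  by rewrite -q1 [X in _ = X - _](bigD1 k)//= addrAC subrr add0r.
have e2 : \sum_(i | i != k) q i * y i = 1.
  by rewrite -y1 [RHS](bigD1 k)//= yk mulr0 add0r.
have M0 := powR_gt0 (r - 1) mu0.
have eM : mu `^ r = mu * mu `^ (r - 1) by rewrite mulr_powRB1 ?(ltW mu0)//; lra.
set M := mu `^ (r - 1) in M0 eM.
have h : (1 - q k) * (mu `^ r - r * M * mu) + r * M <=
    \sum_(i | i != k) q i * `|y i| `^ r.
  rewrite -e1 -[X in _ + X]mulr1 -e2 mulr_suml mulr_sumr -big_split/=.
  apply: ler_sum => i _.
  have := powR_tangent (ltW r1) mu0 (y0 i); rewrite ger0_norm// => hi.
  have : q i * (mu `^ r + r * mu `^ (r - 1) * (y i - mu)) <= q i * y i `^ r.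
    by rewrite ler_pM2l.
  apply: le_trans; rewrite le_eqVlt; apply/orP; left; apply/eqP; rewrite -/M; ring.
have h' : M <= \sum_(i | i != k) q i * `|y i| `^ r.
  apply: le_trans h; rewrite eM.
  have : (1 - q k) * (mu * (r - 1)) <= P * (mu * (r - 1)).
    by rewrite ler_wpM2r// mulr_ge0 ?(ltW mu0)//; lra.
  rewrite [leRHS]mulrA Pmu mul1r => h2.
  have : 0 <= M * ((r - 1) - (1 - q k) * (mu * (r - 1))).
    by rewrite mulr_ge0 ?(ltW M0)// subr_ge0.
  by lra.
apply: (@le_trans _ _ (P `^ (r - 1) * mu `^ (r - 1))).
  by rewrite -powRM ?(ltW P0) ?(ltW mu0)// divff ?powR1// gt_eqF.
by rewrite ler_wpM2l ?powR_ge0.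
Qed.

Lemma simplex_le1 q y i : (forall i, 0 < q i) -> simplex q y -> q i * y i <= 1.
Proof.
move=> q0 [y0 y1]; rewrite -y1 (bigD1 i)//= lerDl sumr_ge0// => j _.
by rewrite mulr_ge0 ?(ltW (q0 j)).
Qed.

(** Each q_i y_i is at most 1, so (q_i y_i)^r <= q_i y_i. *)
Lemma psum_upper_bound q y r Q : 1 < r -> 0 < Q -> (forall i, Q <= q i) ->
  simplex q y -> Q `^ (r - 1) * psum q r y <= 1.
Proof.
move=> r1 Q0 qQ yS; have q0 i : 0 < q i by exact: lt_le_trans (qQ i).
have [y0 y1] := yS.
rewrite -[leRHS]y1 /psum mulr_sumr; apply: ler_sum => i _.
rewrite ger0_norm//; have qy1 := simplex_le1 i q0 yS.
have qy0 : 0 <= q i * y i by rewrite mulr_ge0 ?(ltW (q0 i)).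
apply: (@le_trans _ _ ((q i * y i) `^ r)).
  rewrite powRM ?(ltW (q0 i))// mulrA ler_wpM2r ?powR_ge0//.
  rewrite -[leRHS]mulr_powRB1 ?(ltW (q0 i))//; last lra.
  rewrite [leLHS]mulrC ler_wpM2l ?(ltW (q0 i))//.
  by apply: powR_le; [lra|exact: ltW|exact: qQ].
have [->|qyn0] := eqVneq (q i * y i) 0; first by rewrite powR0// gt_eqF//; lra.
by apply: ge1r_powR; [rewrite lt_neqAle eq_sym qyn0 qy0|exact: ltW].
Qed.

Lemma mixed_at_critical q c r al y lam :
  \sum_i q i * y i = 1 -> \sum_i q i = 1 -> (forall i, 0 < y i) ->
  0 < psum q r y ->
  (forall k, c * psum q r y `^ (al - 1) * y k `^ r +
      (1 - c) * wprod q (r * al) y = lam * y k) ->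
  mixed q c r al y = lam.
Proof.
move=> y1 q1 yp A0 h; rewrite /mixed.
have -> : psum q r y `^ al = psum q r y `^ (al - 1) * psum q r y.
  by rewrite -[X in _ = _ * X]powRr1 ?(ltW A0)// -powRDpos// subrK.
rewrite mulrA; set w := c * _ in h *; set v := (1 - c) * _ in h *.
transitivity (\sum_k q k * (w * y k `^ r + v)).
  rewrite -[v in LHS]mulr1 -q1 /psum !mulr_sumr -big_split/=.
  by apply: eq_bigr => k _; rewrite gtr0_norm//; ring.
rewrite -[RHS]mulr1 -y1 mulr_sumr; apply: eq_bigr => k _.
by rewrite h mulrCA.
Qed.

Lemma wprod_eq0 q e y k : 0 < q k * e -> y k = 0 -> wprod q e y = 0.
Proof.
by move=> qe yk; rewrite /wprod (bigD1 k)//= yk normr0 powR0 ?mul0r// gt_eqF.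
Qed.

Lemma psum_gt0 q r y k : (forall i, 0 < q i) -> 0 < y k -> 0 < psum q r y.
Proof.
move=> q0 yk; rewrite /psum (bigD1 k)//= ltr_pwDl//.
  by rewrite mulr_gt0// powR_gt0// normr_gt0 gt_eqF.
by apply: sumr_ge0 => i _; rewrite mulr_ge0 ?powR_ge0 ?(ltW (q0 i)).
Qed.

Lemma mixed_const q c r al y : \sum_i q i = 1 -> (forall i, y i = 1) ->
  mixed q c r al y = 1.
Proof.
move=> q1 yE.
have -> : mixed q c r al y = c * 1 `^ al + (1 - c) * 1.
  rewrite /mixed; congr (_ * _ `^ _ + _ * _).
    by rewrite -q1; apply: eq_bigr => i _; rewrite yE normr1 powR1 mulr1.
  by apply: big1 => i _; rewrite yE normr1 powR1.
by rewrite powR1; ring.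
Qed.

Lemma simplex_cases q y : (forall i, 0 < q i) -> \sum_i q i = 1 ->
  simplex q y ->
  [\/ exists k, y k = 0, forall i, y i = 1 |
      (forall i, 0 < y i) /\ exists i j, y i < y j].
Proof.
move=> q0 q1 [y0 y1].
have [[k yk]|nz] := pselect (exists k, y k = 0); first by apply: Or31; exists k.
have yp i : 0 < y i.
  by rewrite lt_neqAle y0 andbT; apply/eqP => h; apply: nz; exists i.
have [[i [j ij]]|ne] := pselect (exists i j, y i < y j).
  by apply: Or33; split => //; exists i, j.
have eqy i j : y i = y j.
  by case: (ltgtP (y i) (y j)) => // h; case: ne; [exists i, j|exists j, i].
apply: Or32 => i; rewrite -y1.
under eq_bigr => j _ do rewrite (eqy j i).
by rewrite -mulr_suml q1 mul1r.
Qed.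

(** The conditions of [mixed_critical], multiplied by y_k, say that the points
    (y_k, w y_k^r + v) lie on a line through the origin. *)
Lemma critical_line q c r al y i j :
  (forall k, 0 < q k) -> \sum_k q k = 1 -> simplex q y -> (forall k, 0 < y k) ->
  0 < r -> 0 < al -> y i < y j ->
  (forall z, simplex q z -> mixed q c r al z <= mixed q c r al y) \/
  (forall z, simplex q z -> mixed q c r al y <= mixed q c r al z) ->
  let w := c * psum q r y `^ (al - 1) in
  let v := (1 - c) * wprod q (r * al) y in
  let lam := w * ((y j `^ r - y i `^ r) / (y j - y i)) in
  (forall k, w * y k `^ r + v = lam * y k) /\ mixed q c r al y = lam.
Proof.
move=> q0 q1 yS yp r0 al0 yij ext w v lam.
have A0 : 0 < psum q r y by exact: (psum_gt0 _ q0 (yp i)).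
have crit := mixed_critical q0 yS yp r0 al0 ext.
pose lam' := w * y i `^ (r - 1) + v * (y i)^-1.
have line k : w * y k `^ r + v = lam' * y k.
  rewrite /lam' (crit i k) -/w -/v -[y k `^ r]mulr_powRB1 ?(ltW (yp k))//.
  by field; rewrite gt_eqF.
have ll : lam' = lam.
  rewrite /lam; apply: (@mulIf _ (y j - y i)); first by rewrite subr_eq0 gt_eqF.
  rewrite mulrA divfK ?subr_eq0 ?gt_eqF// mulrBr -!line; ring.
have line' k : w * y k `^ r + v = lam * y k by rewrite line ll.
by split => //; apply: mixed_at_critical => //; have [] := yS.
Qed.

(** The slope in [critical_line] may be taken between any two distinct
    coordinates; the two hypotheses of [two_point_lower] on Q come from
    discarding the other terms of the two sums. *)
Lemma mixed_le1 q Q r a :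
  1 < r -> 0 <= a -> 1 <= r * (1 - a) ->
  (forall t : R, 0 < t < 1 -> superadd_ratio r t `^ a <= (chord r t)^-1) ->
  0 < Q -> (forall i, Q <= q i) -> \sum_i q i = 1 ->
  forall z, simplex q z -> mixed q (Q `^ ((1 - a) * (r - 1))) r (1 - a) z <= 1.
Proof.
move=> r1 a0 ra half Q0 qQ q1.
have q0 i : 0 < q i by exact: lt_le_trans (qQ i).
have r0 : 0 < r by lra.
have al0 : 0 < 1 - a by rewrite -(pmulr_rgt0 _ r0); lra.
set c := Q `^ _; set al := 1 - a in c ra al0 *.
have [|y yS ymax] := @simplex_max R n q (mixed q c r al) q0 q1.
  apply: (@continuous_mixed R n 'rV[R]_n q c r al (fun i v => v ord0 i)) => //.
  by move=> i; exact: coord_continuous.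
move=> z zS; apply: le_trans (ymax z zS) _.
have c0 : 0 <= c by rewrite powR_ge0.
have [[k yk]|yE|[yp [i [j yij]]]] := simplex_cases q0 q1 yS.
- rewrite /mixed (@wprod_eq0 _ _ _ k)//; last by rewrite !mulr_gt0.
  rewrite mulr0 addr0 /c (mulrC al) powRrM -powRM ?powR_ge0 ?psum_ge0//.
  have h := psum_upper_bound r1 Q0 qQ yS.
  have h0 : 0 <= Q `^ (r - 1) * psum q r y by rewrite mulr_ge0 ?powR_ge0 ?psum_ge0.
  by have := powR_le (ltW al0) h0 h; rewrite powR1.
- by rewrite mixed_const.
have [_ ->] := critical_line q0 q1 yS yp r0 al0 yij (or_introl ymax).
have -> : al - 1 = - a by rewrite /al; ring.
have ij : j != i by apply: contraTneq yij => ->; rewrite ltxx.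
have [y0 y1] := yS.
apply: two_point_lower => //; first by rewrite yp.
  rewrite -y1 (bigD1 i)//= (bigD1 j)//= mulrDr addrA.
  rewrite -[leLHS]addr0; apply: lerD; last first.
    by apply: sumr_ge0 => k _; rewrite mulr_ge0 ?(ltW (q0 k)).
  by apply: lerD; rewrite ler_pM2r.
rewrite /psum (bigD1 i)//= (bigD1 j)//= mulrDr addrA !gtr0_norm//.
rewrite -[leLHS]addr0; apply: lerD; last first.
  by apply: sumr_ge0 => k _; rewrite mulr_ge0 ?powR_ge0 ?(ltW (q0 k)).
by apply: lerD; rewrite ler_pM2r// powR_gt0.
Qed.

(** Here an upper bound on the weighted sum in terms of two values is required,
    so all coordinates must be controlled: there are only two values, and the
    coordinates are grouped accordingly. Each group has weight at least Q,
    hence at most 1 - Q. *)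
Lemma mixed_ge1 q Q r a :
  1 < r -> 0 <= a ->
  (forall t : R, 0 < t < 1 -> superadd_ratio r t `^ a <= chord r t) ->
  0 < Q < 1 -> (forall i, 0 < q i) -> (forall i, Q <= q i) -> \sum_i q i = 1 ->
  forall z, simplex q z ->
  1 <= mixed q ((1 - Q) `^ ((1 + a) * (r - 1))) r (1 + a) z.
Proof.
move=> r1 a0 half /andP[Q0 Q1] q0 qQ q1.
have r0 : 0 < r by lra.
have al0 : 0 < 1 + a by lra.
have P0 : 0 < 1 - Q by lra.
set c := (1 - Q) `^ _; set al := 1 + a in c al0 *.
have [|y yS ymin] := @simplex_min R n q (mixed q c r al) q0 q1.
  apply: (@continuous_mixed R n 'rV[R]_n q c r al (fun i v => v ord0 i)) => //.
  by move=> i; exact: coord_continuous.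
move=> z zS; apply: le_trans (ymin z zS).
have c0 : 0 < c by rewrite powR_gt0.
have [[k yk]|yE|[yp [i [j yij]]]] := simplex_cases q0 q1 yS.
- rewrite /mixed (@wprod_eq0 _ _ _ k)//; last by rewrite !mulr_gt0.
  rewrite mulr0 addr0 /c (mulrC al) powRrM -powRM ?powR_ge0 ?psum_ge0//.
  apply: powR_ge1; first exact: ltW.
  by apply: (face_lower_bound r1 q0 q1 yS yk P0); rewrite lerD2l lerN2.
- by rewrite mixed_const.
have [line ->] := critical_line q0 q1 yS yp r0 al0 yij (or_intror ymin).
set w := c * _ in line *; set v := (1 - c) * _ in line.
have -> : w = c * psum q r y `^ a by rewrite /w /al addrAC subrr add0r.
have A0 : 0 < psum q r y by exact: (psum_gt0 _ q0 (yp i)).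
have w0 : 0 < w by rewrite mulr_gt0// powR_gt0.
(* A line cannot meet the graph of the strictly convex w y^r + v three times:
   the tangent at the middle point lies strictly below the two outer points. *)
have two k : (y k == y i) || (y k == y j).
  apply/negP => /negP; rewrite negb_or => /andP[ki kj].
  have conv x m u : 0 < x -> x < m -> m < u ->
      (exists l, [/\ w * x `^ r + v = l * x, w * m `^ r + v = l * m &
                     w * u `^ r + v = l * u]) -> False.
    move=> x0 xm mu [l [ex em eu]].
    have m0 : 0 < m by lra.
    have tx : m `^ r + r * m `^ (r - 1) * (x - m) < x `^ r.
      by apply: powR_tangent_lt => //; [exact: ltW|rewrite lt_eqF].
    have tu : m `^ r + r * m `^ (r - 1) * (u - m) < u `^ r.
      by apply: powR_tangent_lt => //; [lra|rewrite gt_eqF].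
    have hx : w * (m `^ r + r * m `^ (r - 1) * (x - m)) < w * x `^ r.
      by rewrite ltr_pM2l.
    have hu : w * (m `^ r + r * m `^ (r - 1) * (u - m)) < w * u `^ r.
      by rewrite ltr_pM2l.
    pose d := w * (r * m `^ (r - 1)) - l.
    have hx' : d * (x - m) < 0 by rewrite /d; lra.
    have hu' : d * (u - m) < 0 by rewrite /d; lra.
    have d0 : d < 0 by move: hu'; rewrite pmulr_llt0 ?subr_gt0.
    by move: hx'; rewrite nmulr_rlt0// subr_gt0 ltNge (ltW xm).
  have L := line; have yi := yp i; have yk := yp k.
  move: ki kj; rewrite !neq_lt => /orP[h1|h1] /orP[h2|h2].
  - by apply: (conv _ _ _ yk h1 yij); eexists; split; exact: line.
  - by have := lt_trans (lt_trans h1 yij) h2; rewrite ltxx.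
  - by apply: (conv _ _ _ yi h1 h2); eexists; split; exact: line.
  - by apply: (conv _ _ _ yi yij h2); eexists; split; exact: line.
have [y0 y1] := yS.
pose px := \sum_(k | y k == y i) q k.
pose py := \sum_(k | y k != y i) q k.
have pxy : px + py = 1 by rewrite -q1 /px /py [RHS](bigID (fun k => y k == y i)).
have split_sum (f : R -> R) : \sum_k q k * f (y k) = px * f (y i) + py * f (y j).
  rewrite (bigID (fun k => y k == y i))/= /px /py !mulr_suml; congr (_ + _).
    by apply: eq_bigr => k /eqP ->.
  by apply: eq_bigr => k /negbTE h; have := two k; rewrite h/= => /eqP ->.
have pxQ : Q <= px.
  rewrite /px (bigD1 i)//=; apply: le_trans (qQ i) _.
  by rewrite lerDl sumr_ge0// => k _; exact: ltW.
have pyQ : Q <= py.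
  rewrite /py (bigD1 j)/=; last by rewrite gt_eqF.
  apply: le_trans (qQ j) _.
  by rewrite lerDl sumr_ge0// => k _; exact: ltW.
have -> : psum q r y = px * y i `^ r + py * y j `^ r.
  rewrite -(split_sum (fun x => x `^ r)) /psum.
  by apply: eq_bigr => k _; rewrite gtr0_norm.
apply: two_point_upper => //; rewrite ?yp//; [lra|lra|].
by rewrite -(split_sum id).
Qed.

End Bounds.

(** * From the simplex to the means *)

Section Means.
Context {R : realType} {n : nat}.
Implicit Types (q x y : 'I_n -> R) (c r al Q : R).

Lemma powR_prod (F : 'I_n -> R) (e : R) : (forall i, 0 <= F i) ->
  \prod_i F i `^ e = (\prod_i F i) `^ e.
Proof.
move=> F0; suff [_ ->] : 0 <= \prod_i F i /\ \prod_i F i `^ e = (\prod_i F i) `^ e by [].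
elim/big_rec2: _ => [|i a b _ [b0 ->]]; first by rewrite powR1.
by rewrite powRM// mulr_ge0.
Qed.

Lemma prod_powR (m : R) (F : 'I_n -> R) : 0 < m ->
  \prod_i m `^ F i = m `^ (\sum_i F i).
Proof.
move=> m0; elim/big_rec2: _ => [|i a b _ ->]; first by rewrite powRr0.
by rewrite powRDpos.
Qed.

(** Multiply the inequalities x_i / A <= exp(x_i / A - 1), raised to the power
    q_i, where A is the arithmetic mean. *)
Lemma weighted_amgm q x : (forall i, 0 < q i) -> \sum_i q i = 1 ->
  (forall i, 0 <= x i) -> \prod_i x i `^ q i <= \sum_i q i * x i.
Proof.
move=> q0 q1 x0; set A := \sum_i q i * x i.
have A0 : 0 <= A.
  by apply: sumr_ge0 => i _; rewrite mulr_ge0 ?(ltW (q0 i)).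
have [AE|An0] := eqVneq A 0.
  have xE i : x i = 0.
    have : q i * x i <= A.
      rewrite /A (bigD1 i)//= lerDl sumr_ge0// => j _.
      by rewrite mulr_ge0 ?(ltW (q0 j)).
    rewrite AE pmulr_rle0// => xi; apply/eqP; rewrite eq_le xi.
    exact: x0.
  have [i _] : exists i : 'I_n, true.
    case: n q q1 {x x0 A A0 AE xE q0} => [|k] q q1; last by exists ord0.
    by move: q1; rewrite big_ord0 => /esym/eqP; rewrite oner_eq0.
  by rewrite AE (bigD1 i)//= xE powR0 ?mul0r// gt_eqF.
have {}A0 : 0 < A by rewrite lt_neqAle eq_sym An0.
apply: (@le_trans _ _ (\prod_i (A `^ q i * expR (q i * (x i / A - 1))))).
  apply: ler_prod => i _; rewrite powR_ge0/=.
  have -> : x i = A * (x i / A) by rewrite mulrCA divff ?mulr1// gt_eqF.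
  have xA : 0 <= x i / A by rewrite divr_ge0 ?(ltW A0).
  rewrite powRM ?(ltW A0)// ler_wpM2l ?powR_ge0//.
  rewrite [A * _]mulrCA divff ?gt_eqF// mulr1 [q i * _]mulrC expRM.
  apply: powR_le => //; first exact: ltW.
  by have := expR_ge1Dx (x i / A - 1); lra.
rewrite big_split/= prod_powR// q1 powRr1 ?(ltW A0)// -expR_sum.
have -> : \sum_i q i * (x i / A - 1) = 0.
  under eq_bigr do rewrite mulrBr mulr1 mulrA.
  by rewrite sumrB q1 -mulr_suml -/A divff ?subrr.
by rewrite expR0 mulr1.
Qed.

Lemma arith_meanE q x : (forall i, 0 < q i) -> (forall i, 0 <= x i) ->
  arith_mean q x = \sum_i q i * x i.
Proof.
move=> q0 x0; rewrite /arith_mean /power_mean oner_eq0 divr1.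
under eq_bigr do rewrite powRr1//.
by rewrite powRr1// sumr_ge0// => i _; rewrite mulr_ge0 ?(ltW (q0 i)).
Qed.

Lemma geom_meanE q x : geom_mean q x = \prod_i x i `^ q i.
Proof. by rewrite /geom_mean /power_mean eqxx. Qed.

Lemma power_meanVE q x r : 0 < r ->
  power_mean q x (1 / r) = (\sum_i q i * x i `^ (1 / r)) `^ r.
Proof.
move=> r0; rewrite /power_mean ifF; last by rewrite gt_eqF// divr_gt0.
by rewrite div1r div1r invrK.
Qed.

(** The point of the simplex at which [mixed] is, up to a factor, the
    combination of the arithmetic and the geometric mean. *)
Definition root_point q x r : 'I_n -> R :=
  fun i => x i `^ (1 / r) / \sum_j q j * x j `^ (1 / r).

Lemma root_point_simplex q x r : (forall i, 0 < q i) ->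
  0 < \sum_j q j * x j `^ (1 / r) -> simplex q (root_point q x r).
Proof.
move=> q0 m0; split=> [i|]; first by rewrite divr_ge0 ?powR_ge0 ?(ltW m0).
rewrite /root_point; under eq_bigr do rewrite mulrA.
by rewrite -mulr_suml divff// gt_eqF.
Qed.

Lemma psum_root_point q x r : (forall i, 0 < q i) -> (forall i, 0 <= x i) ->
  0 < r -> 0 < \sum_j q j * x j `^ (1 / r) ->
  psum q r (root_point q x r) = arith_mean q x / power_mean q x (1 / r).
Proof.
move=> q0 x0 r0 m0; rewrite arith_meanE// power_meanVE//.
rewrite /psum /root_point mulr_suml; apply: eq_bigr => i _.
set m := \sum_j _ in m0 *.
rewrite ger0_norm ?divr_ge0 ?powR_ge0 ?(ltW m0)//.
rewrite powRM ?powR_ge0 ?invr_ge0 ?(ltW m0)// -powRrM divfK ?gt_eqF// powRr1//.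
by rewrite -(powR_inv1 (ltW m0)) -powRrM mulN1r powRN mulrA.
Qed.

Lemma wprod_root_point q x r al : \sum_i q i = 1 -> (forall i, 0 <= x i) ->
  0 < r -> 0 < \sum_j q j * x j `^ (1 / r) ->
  wprod q (r * al) (root_point q x r) =
  geom_mean q x `^ al / power_mean q x (1 / r) `^ al.
Proof.
move=> q1 x0 r0 m0; rewrite geom_meanE power_meanVE//.
rewrite /wprod /root_point.
set m := \sum_j _ in m0 *.
transitivity (\prod_i ((x i `^ q i) `^ al * m `^ (q i * - (r * al)))).
  apply: eq_bigr => i _; rewrite ger0_norm ?divr_ge0 ?powR_ge0 ?(ltW m0)//.
  rewrite powRM ?powR_ge0 ?invr_ge0 ?(ltW m0)// -!powRrM.
  congr (_ `^ _ * _); first by field; rewrite gt_eqF.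
  by rewrite -(powR_inv1 (ltW m0)) -powRrM; congr (_ `^ _); ring.
rewrite big_split/= powR_prod; last by move=> i; exact: powR_ge0.
by rewrite prod_powR// -mulr_suml q1 mul1r powRN powRrM.
Qed.

Lemma mixed_root_point q x r al c : (forall i, 0 < q i) -> \sum_i q i = 1 ->
  (forall i, 0 <= x i) -> 0 < r -> 0 < \sum_j q j * x j `^ (1 / r) ->
  mixed q c r al (root_point q x r) * power_mean q x (1 / r) `^ al =
  c * arith_mean q x `^ al + (1 - c) * geom_mean q x `^ al.
Proof.
move=> q0 q1 x0 r0 m0; rewrite /mixed psum_root_point// wprod_root_point//.
have M0 : 0 < power_mean q x (1 / r) by rewrite power_meanVE// powR_gt0.
have A0 : 0 <= arith_mean q x.
  by rewrite arith_meanE// sumr_ge0// => i _; rewrite mulr_ge0 ?(ltW (q0 i)).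
move: (arith_mean q x) (power_mean q x (1 / r)) (geom_mean q x) A0 M0.
move=> A M G A0 M0; have M1 := powR_gt0 al M0.
rewrite powRM ?invr_ge0 ?(ltW M0)//.
have -> : M^-1 `^ al = (M `^ al)^-1.
  by rewrite -powR_inv1 ?(ltW M0)// -powRrM mulN1r powRN.
by field; rewrite gt_eqF.
Qed.

Lemma psum_gt1 q y r k : (forall i, 0 < q i) -> \sum_i q i = 1 ->
  1 < r -> simplex q y -> y k != 1 -> 1 < psum q r y.
Proof.
move=> q0 q1 r1 [y0 y1] yk.
have -> : 1 = \sum_i q i * (1 + r * (y i - 1)).
  under eq_bigr do rewrite mulrDr mulr1 mulrCA mulrBr mulr1.
  by rewrite big_split/= q1 -mulr_sumr sumrB y1 q1 subrr mulr0 addr0.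
rewrite /psum (bigD1 k)//= [ltRHS](bigD1 k)//=.
apply: ltr_leD.
  by rewrite ltr_pM2l// ger0_norm// bernoulli_gt1.
apply: ler_sum => i _; rewrite ler_pM2l// ger0_norm//.
by apply: bernoulli_ge1 => //; exact: ltW.
Qed.

End Means.

Section Exponent.
Context {R : realType}.
Implicit Types (c P e A G M al : R).

Lemma mix_lower_exponent P e A G M al al' : 0 <= P <= 1 -> 0 <= e ->
  0 <= G <= A -> 0 <= M -> 0 < al <= al' ->
  M `^ al' <= P `^ (al' * e) * A `^ al' + (1 - P `^ (al' * e)) * G `^ al' ->
  M `^ al <= P `^ (al * e) * A `^ al + (1 - P `^ (al * e)) * G `^ al.
Proof.
move=> /andP[P0 P1] e0 /andP[G0 GA] M0 /andP[al0 al1] main.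
have al'0 : 0 < al' by exact: lt_le_trans al1.
have b01 : 0 < al / al' <= 1 by rewrite divr_gt0//= ler_pdivrMr// mul1r.
have u01 : 0 <= P `^ (al' * e) <= 1.
  by rewrite powR_ge0; have := powR_le (mulr_ge0 (ltW al'0) e0) P0 P1; rewrite powR1.
have ga : 0 <= G `^ al' <= A `^ al'.
  by apply/andP; split; [exact: powR_ge0|apply: powR_le => //; exact: ltW].
have := powR_mix_concave b01 u01 ga (powR_ge0 _ _) main.
have E : al' * (al / al') = al by rewrite mulrCA divff ?mulr1// gt_eqF.
by rewrite -!powRrM (mulrAC _ e) E.
Qed.

Lemma mix_raise_exponent P e A G M al al' : 0 <= P <= 1 -> 0 <= e ->
  0 <= G <= A -> 0 <= M -> 0 < al' <= al ->
  P `^ (al' * e) * A `^ al' + (1 - P `^ (al' * e)) * G `^ al' <= M `^ al' ->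
  P `^ (al * e) * A `^ al + (1 - P `^ (al * e)) * G `^ al <= M `^ al.
Proof.
move=> /andP[P0 P1] e0 /andP[G0 GA] M0 /andP[al'0 al1] main.
have b1 : 1 <= al / al' by rewrite ler_pdivlMr// mul1r.
have /andP[u0 u1] : 0 <= P `^ (al' * e) <= 1.
  by rewrite powR_ge0; have := powR_le (mulr_ge0 (ltW al'0) e0) P0 P1; rewrite powR1.
have ga : 0 <= G `^ al' <= A `^ al'.
  by apply/andP; split; [exact: powR_ge0|apply: powR_le => //; exact: ltW].
have u01 : 0 <= P `^ (al' * e) <= 1 by rewrite u0.
have h2 := powR_mix b1 u01 ga.
have b0 : 0 <= al / al' by exact: le_trans ler01 b1.
have X0 : 0 <= P `^ (al' * e) * A `^ al' + (1 - P `^ (al' * e)) * G `^ al'.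
  by rewrite addr_ge0// mulr_ge0 ?powR_ge0// subr_ge0.
have := le_trans h2 (powR_le b0 X0 main).
have E : al' * (al / al') = al by rewrite mulrCA divff ?mulr1// gt_eqF.
by rewrite -!powRrM (mulrAC _ e) E.
Qed.

Lemma ratio_le_of_mix c A G M : c < 1 -> M < A -> G <= A ->
  M <= c * A + (1 - c) * G -> `|(A - G) / (A - M)| <= 1 / (1 - c).
Proof.
move=> c1 DA DG h.
rewrite ger0_norm; last by rewrite divr_ge0 ?subr_ge0// ltW.
rewrite ler_pdivrMr ?subr_gt0// mulrAC ler_pdivlMr ?subr_gt0//.
by lra.
Qed.

Lemma ratio_ge_of_mix c A G M : c < 1 -> M < A ->
  c * A + (1 - c) * G <= M -> 1 / (1 - c) <= `|(A - G) / (A - M)|.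
Proof.
move=> c1 DA h; apply: le_trans (ler_norm _).
rewrite ler_pdivlMr ?subr_gt0// mulrAC ler_pdivrMr ?subr_gt0//.
by lra.
Qed.

End Exponent.

Section Final.
Context {R : realType} {n : nat}.
Implicit Types (q x : 'I_n -> R) (r al Q : R).

Lemma min_weight_le q i : min_weight q <= q i.
Proof. by apply/bigmin_leP; right; exists i. Qed.

Lemma min_weight_gt0 q : (forall i, 0 < q i) -> 0 < min_weight q.
Proof. by move=> q0; apply: lt_bigmin. Qed.

Lemma min_weight_lt1 q : (2 <= n)%N -> (forall i, 0 < q i) ->
  \sum_i q i = 1 -> min_weight q < 1.
Proof.
move=> n2 q0 q1; pose i0 : 'I_n := Ordinal (ltnW n2); pose i1 : 'I_n := Ordinal n2.
apply: le_lt_trans (min_weight_le q i0) _.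
rewrite -q1 (bigD1 i0)//= ltrDl (bigD1 i1)//= ltr_pwDl//.
by apply: sumr_ge0 => i _; exact: ltW.
Qed.

(** M < A is strict because n >= 2 provides two distinct x_i; this makes the
    denominator of the ratio nonzero. *)
Lemma mean_chain q x r : (2 <= n)%N -> admissible_weights q ->
  admissible_points x -> 1 < r ->
  [/\ 0 <= geom_mean q x <= arith_mean q x,
      0 < \sum_j q j * x j `^ (1 / r) &
      0 < power_mean q x (1 / r) < arith_mean q x].
Proof.
move=> n2 [q0 q1] [x0 xinc] r1; have r0 : 0 < r by lra.
pose i0 : 'I_n := Ordinal (ltnW n2); pose i1 : 'I_n := Ordinal n2.
have x01 : x i0 < x i1 by exact: xinc.
have x1 : 0 < x i1 by exact: le_lt_trans x01.
have m0 : 0 < \sum_j q j * x j `^ (1 / r).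
  rewrite (bigD1 i1)//= ltr_pwDl ?mulr_gt0 ?powR_gt0//.
  by apply: sumr_ge0 => i _; rewrite mulr_ge0 ?powR_ge0 ?(ltW (q0 i)).
have M0 : 0 < power_mean q x (1 / r) by rewrite power_meanVE// powR_gt0.
split => //.
  rewrite geom_meanE arith_meanE// weighted_amgm// andbT.
  by apply: prodr_ge0 => i _; exact: powR_ge0.
rewrite M0/=.
have yS := root_point_simplex q0 m0.
have [k yk] : exists k, root_point q x r k != 1.
  have [e0|] := eqVneq (root_point q x r i0) 1; last by exists i0.
  exists i1; apply: contraTneq x01 => e1.
  have : x i0 `^ (1 / r) = x i1 `^ (1 / r).
    apply: (@mulIf _ (\sum_j q j * x j `^ (1 / r))^-1).
      by rewrite invr_eq0 gt_eqF.
    exact: etrans e0 (esym e1).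
  have ri : 0 < 1 / r by rewrite divr_gt0.
  by move=> /(powR_injective ri) ->; rewrite ?ltxx// nnegrE.
have := psum_gt1 q0 q1 r1 yS yk.
rewrite (psum_root_point q0 x0 r0 m0).
move: (arith_mean q x) (power_mean q x (1 / r)) M0 => A M M0.
by rewrite ltr_pdivlMr// mul1r.
Qed.

Lemma power_mean_mix_le q x r al : (2 <= n)%N -> admissible_weights q ->
  admissible_points x -> 1 < r < 2 -> 0 < al <= 1 + a1 r ->
  power_mean q x (1 / r) `^ al <=
    (1 - min_weight q) `^ (al * (r - 1)) * arith_mean q x `^ al +
    (1 - (1 - min_weight q) `^ (al * (r - 1))) * geom_mean q x `^ al.
Proof.
move=> n2 qW xP r12 /andP[al0 al1]; have /andP[r1 r2] := r12.
have [GA' m0 /andP[M0 _]] := mean_chain n2 qW xP r1.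
have [q0 q1] := qW; have [x0 _] := xP.
have Q0 := min_weight_gt0 q0; have Q1 := min_weight_lt1 n2 q0 q1.
set Q := min_weight q in Q0 Q1 *.
have a0 : 0 < a1 r by exact: a1_gt0.
have r0 : 0 < r by lra.
have half t : 0 < t < 1 -> superadd_ratio r t `^ a1 r <= chord r t.
  by apply: superadd_ratio_le_chord => //; exact: t1P.
have Q01 : 0 < Q < 1 by rewrite Q0.
have P01 : 0 <= 1 - Q <= 1 by lra.
have e0 : 0 <= r - 1 by lra.
have al01 : 0 < al <= 1 + a1 r by rewrite al0.
apply: (mix_lower_exponent P01 e0 GA' (ltW M0) al01).
rewrite -(mixed_root_point (1 + a1 r) _ q0 q1 x0 r0 m0) -[leLHS]mul1r.
apply: ler_wpM2r; first exact: powR_ge0.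
exact: (mixed_ge1 r1 (ltW a0) half Q01 q0 (min_weight_le q) q1
  (root_point_simplex q0 m0)).
Qed.

Lemma power_mean_mix_ge q x r al : (2 <= n)%N -> admissible_weights q ->
  admissible_points x -> 2 < r -> alpha_bound r <= al ->
  min_weight q `^ (al * (r - 1)) * arith_mean q x `^ al +
    (1 - min_weight q `^ (al * (r - 1))) * geom_mean q x `^ al <=
  power_mean q x (1 / r) `^ al.
Proof.
move=> n2 qW xP r2 al1; have r1 : 1 < r by lra.
have [GA' m0 /andP[M0 _]] := mean_chain n2 qW xP r1.
have [q0 q1] := qW; have [x0 _] := xP.
have Q0 := min_weight_gt0 q0; have Q1 := min_weight_lt1 n2 q0 q1.
set Q := min_weight q in Q0 Q1 *.
have r0 : 0 < r by lra.
have /andP[ab1 ab2] := alpha_bound_le1 r2.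
have a0 : 0 <= 1 - alpha_bound r by lra.
have ra : 1 <= r * (1 - (1 - alpha_bound r)).
  by rewrite opprB addrC subrK -(divff (lt0r_neq0 r0)) ler_pM2l.
have ab0 : 0 < alpha_bound r by apply: lt_le_trans ab1; rewrite invr_gt0.
have P01 : 0 <= Q <= 1 by rewrite (ltW Q0) (ltW Q1).
have e0 : 0 <= r - 1 by lra.
have al01 : 0 < alpha_bound r <= al by rewrite ab0.
apply: (mix_raise_exponent P01 e0 GA' (ltW M0) al01).
rewrite -(mixed_root_point (alpha_bound r) _ q0 q1 x0 r0 m0) -[leRHS]mul1r.
apply: ler_wpM2r; first exact: powR_ge0.
have E : 1 - (1 - alpha_bound r) = alpha_bound r by rewrite opprB addrC subrK.
have := mixed_le1 r1 a0 ra (fun t => superadd_ratio_le_invchord r2) Q0 (min_weight_le q) q1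
  (root_point_simplex q0 m0).
by rewrite E.
Qed.

End Final.

Theorem corollary1p1 (R : realType) :
  (forall r : R, 1 < r < 2 -> (exists! t, t1_spec r t) /\ 0 < a1 r) /\
  (forall r : R, 2 < r < 3 -> (exists! t, t2_spec r t) /\ 0 < a2 r) /\
  (forall (n : nat) (q x : 'I_n -> R), (2 <= n)%N ->
    admissible_weights q -> admissible_points x ->
    (forall r alpha : R, 1 < r < 2 -> 0 < alpha <= 1 + a1 r ->
      1 / (1 - (1 - min_weight q) `^ (alpha * (r - 1)))
        >= mean_ratio q x r alpha) /\
    (forall r alpha : R, 2 < r -> alpha >= alpha_bound r ->
      mean_ratio q x r alpha
        >= 1 / (1 - min_weight q `^ (alpha * (r - 1))))).
Proof.
split; first by move=> r r12; split; [exact: t1_exists|exact: a1_gt0].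
split; first by move=> r r12; split; [exact: t2_exists|exact: a2_gt0].
move=> n q x n2 qW xP; have [q0 q1] := qW.
have Q0 := min_weight_gt0 q0; have Q1 := min_weight_lt1 n2 q0 q1.
split=> r al.
- move=> r12 al01; have /andP[r1 r2] := r12; have /andP[al0 _] := al01.
  have [/andP[G0 GA] _ /andP[M0 MA]] := mean_chain n2 qW xP r1.
  have c1 : (1 - min_weight q) `^ (al * (r - 1)) < 1.
    apply: powR_lt1; first by rewrite mulr_gt0// subr_gt0.
    by rewrite subr_ge0 (ltW Q1) ltrBlDr ltrDl.
  exact: (ratio_le_of_mix c1 (powR_lt al0 (ltW M0) MA)
    (powR_le (ltW al0) G0 GA) (power_mean_mix_le n2 qW xP r12 al01)).
- move=> r2 al1; have r1 : 1 < r by lra.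
  have [_ _ /andP[M0 MA]] := mean_chain n2 qW xP r1.
  have al0 : 0 < al.
    have /andP[h _] := alpha_bound_le1 r2.
    by apply: lt_le_trans al1; apply: lt_le_trans h; rewrite invr_gt0; lra.
  have c1 : min_weight q `^ (al * (r - 1)) < 1.
    apply: powR_lt1; first by rewrite mulr_gt0// subr_gt0.
    by rewrite (ltW Q0).
  exact: (ratio_ge_of_mix c1 (powR_lt al0 (ltW M0) MA)
    (power_mean_mix_ge n2 qW xP r2 al1)).
Qed.
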